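(* Let $\mathbf{k}$ be a field of characteristic zero and $B$ an affine $\mathbf{k}$-domain. If $\mathrm{FML}(B)=\mathbf{k}$ then the following hold. (a) The set $\mathcal{X}_{\mathbf{k}}(B)$ has nonempty interior, i.e., there is a nonempty Zariski-open subset of $\mathrm{Spec}\, B$ such that for every prime ideal $\mathfrak{p}$ in it there exists an injective homomorphism of $\kappa(\mathfrak{p})$-algebras from $\kappa(\mathfrak{p})\otimes_{\mathbf{k}} B$ to a polynomial ring in $\dim B$ variables over $\kappa(\mathfrak{p})$. (b) Given any subset $\Delta$ of $\mathrm{LND}(B)$ satisfying $K_\Delta=\mathbf{k}$, there exist a finite sequence $\mathcal{S}=(D_1,\dots,D_N)$ of elements of $\Delta$ and a nonempty Zariski-open subset $U$ of $\mathrm{Spec}\, B$ such that, for each $\mathfrak{p}\in U$, the $\kappa(\mathfrak{p})$-homomorphism $\hat\Psi_{\mathcal{S}}^{\mathfrak{p}}:\kappa(\mathfrak{p})\otimes_{\mathbf{k}}B\to\kappa(\mathfrak{p})[X_1,\dots,X_N]$ is injective.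
   Context: Rings are commutative with unity, and $0\in\mathbb{N}$. A domain is an integral domain; an affine $\mathbf{k}$-domain is a domain that is a finitely generated $\mathbf{k}$-algebra. For $\mathfrak{p}\in\mathrm{Spec}\,B$, $\kappa(\mathfrak{p})=B_{\mathfrak{p}}/\mathfrak{p}B_{\mathfrak{p}}$. $\dim B$ is the Krull dimension. $\mathrm{LND}(B)$ is the set of derivations $D:B\to B$ that are locally nilpotent, i.e. for every $x\in B$ there is $n\in\mathbb{N}$ with $D^n(x)=0$. For $\Delta\subseteq\mathrm{LND}(B)$, $K_\Delta=\bigcap_{D\in\Delta}\mathrm{Frac}(\ker D)$, the intersection being taken in $\mathrm{Frac}\,B$ (so $K_\emptyset=\mathrm{Frac}\,B$), and $\mathrm{FML}(B)=K_{\mathrm{LND}(B)}$. When $B$ is a $\mathbf{k}$-domain with $\mathrm{char}\,\mathbf{k}=0$, one has $\mathbf{k}\subseteq\mathrm{FML}(B)$. $\mathcal{X}_{\mathbf{k}}(B)$ is the set of $\mathfrak{p}\in\mathrm{Spec}\,B$ such that, for some $n\in\mathbb{N}$, there exists an injective homomorphism of $\kappa(\mathfrak{p})$-algebras from $\kappa(\mathfrak{p})\otimes_{\mathbf{k}}B$ to a polynomial ring in $n$ variables over $\kappa(\mathfrak{p})$. It ''has nonempty interior'' if it contains a nonempty Zariski-open subset of $\mathrm{Spec}\,B$. For a finite sequence $\mathcal{S}=(D_1,\dots,D_N)$ of (not necessarily distinct) elements of $\mathrm{LND}(B)$, where $N\ge 1$, define the $\mathbf{k}$-homomorphism $\Psi_{\mathcal{S}}:B\to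 B[X_1,\dots,X_N]$ (polynomial ring) by $$\Psi_{\mathcal{S}}(b)=\sum_{(i_1,\dots,i_N)\in\mathbb{N}^N}\frac{(D_N^{i_N}\circ\cdots\circ D_1^{i_1})(b)}{i_1!\cdots i_N!}\,X_1^{i_1}\cdots X_N^{i_N}.$$ For $\mathfrak{p}\in\mathrm{Spec}\,B$, let $\Psi_{\mathcal{S}}^{\mathfrak{p}}:B\to\kappa(\mathfrak{p})[X_1,\dots,X_N]$ be the composition of $\Psi_{\mathcal{S}}$ with the homomorphism $B[X_1,\dots,X_N]\to\kappa(\mathfrak{p})[X_1,\dots,X_N]$ that applies the canonical map $B\to\kappa(\mathfrak{p})$ to coefficients and fixes each $X_i$. Then $\hat\Psi_{\mathcal{S}}^{\mathfrak{p}}:\kappa(\mathfrak{p})\otimes_{\mathbf{k}}B\to\kappa(\mathfrak{p})[X_1,\dots,X_N]$ is the $\kappa(\mathfrak{p})$-homomorphism given by $\lambda\otimes b\mapsto\lambda\,\Psi_{\mathcal{S}}^{\mathfrak{p}}(b)$.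
   Formalization: In (b), N ≥ 1 is required only when Δ is nonempty; if Δ is empty (which forces B = k, where no sequence with N ≥ 1 exists and the claim as written fails), the empty sequence N = 0 is allowed. *)

(* Defs.v *)
From HB Require Import structures.
From mathcomp Require Import all_boot all_algebra.
From mathcomp Require Import mpoly boolp.

Set Implicit Arguments.
Unset Strict Implicit.
Unset Printing Implicit Defensive.

Import GRing.Theory.
Local Open Scope ring_scope.
Local Open Scope quotient_scope.

Notation "x %:F" := (@FracField.tofrac _ x) : ring_scope.

#[short(type="domAlgType")]
HB.structure Definition DomAlgebra (k : nzRingType) :=
  {B of GRing.Algebra k B & GRing.IntegralDomain B}.

(* Every subset of B is a boolean predicate in the presence of the classical
   axioms of boolp, so [prime_idealr B] really is the set of all primes. *)
Notation Spec B := (prime_idealr B).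

Definition zariski_open (B : comNzRingType) (U : Spec B -> Prop) : Prop :=
  exists E : B -> Prop,
    forall p : Spec B, U p <-> exists2 f, E f & f \notin p.

Definition has_nonempty_interior (B : comNzRingType) (X : Spec B -> Prop) :=
  exists U : Spec B -> Prop,
    [/\ zariski_open U, exists p, U p & forall p, U p -> X p].

Definition prime_chain (B : comNzRingType) (n : nat) : Prop :=
  exists p : nat -> Spec B, forall i, (i < n)%N ->
    {subset p i <= p i.+1} /\ ~ {subset p i.+1 <= p i}.

Definition is_krull_dim (B : comNzRingType) (d : nat) : Prop :=
  prime_chain B d /\ forall n, prime_chain B n -> (n <= d)%N.

Definition finitely_generated (k : comNzRingType) (B : comAlgType k) : Prop :=
  exists n (g : 'I_n -> B), forall b,
    exists P : {mpoly k[n]}, b = mmap (in_alg B) g P.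

(* The localization B_p is realized inside Frac B, B being a domain. *)
Section Localization.
Variables (B : idomainType) (p : Spec B).

Definition loc_pred : {pred {fraction B}} :=
  fun x => `[< exists a s, s \notin p /\ x = a%:F / s%:F >].

Lemma spec_neq0 s : s \notin p -> s%:F != 0.
Proof.
by apply: contra; rewrite -tofrac0 tofrac_eq => /eqP ->; exact: rpred0.
Qed.

Lemma spec_mul s t : s \notin p -> t \notin p -> s * t \notin p.
Proof. by move=> sp tp; rewrite prime_idealrM negb_or sp. Qed.

Lemma spec1 : 1 \notin p.
Proof. by rewrite idealr1. Qed.

Lemma loc_pred_subring : subring_closed loc_pred.
Proof.
split=> [|x y|x y].
- by apply/asboolP; exists 1, 1; rewrite spec1 divff ?spec_neq0 ?spec1.
- move=> /asboolP [a [s [sp ->]]] /asboolP [b [t [tp ->]]].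
  apply/asboolP; exists (a * t - b * s), (s * t); split; first exact: spec_mul.
  by rewrite -mulNr addf_div ?spec_neq0 // tofracB !tofracM mulNr.
- move=> /asboolP [a [s [sp ->]]] /asboolP [b [t [tp ->]]].
  apply/asboolP; exists (a * b), (s * t); split; first exact: spec_mul.
  by rewrite mulf_div !tofracM.
Qed.

HB.instance Definition _ :=
  GRing.isSubringClosed.Build {fraction B} loc_pred loc_pred_subring.

Record loc := Loc {loc_val : {fraction B}; loc_valP : loc_val \in loc_pred}.

HB.instance Definition _ := [isSub for loc_val].
HB.instance Definition _ := [Choice of loc by <:].
HB.instance Definition _ :=
  [SubChoice_isSubComNzRing of loc by <:].

Lemma to_loc_subproof b : b%:F \in loc_pred.
Proof. by apply/asboolP; exists b, 1; rewrite spec1 tofrac1 divr1. Qed.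

Definition to_loc b := Loc (to_loc_subproof b).

Lemma to_loc_zmod : zmod_morphism to_loc.
Proof. by move=> a b; apply: val_inj; rewrite /= tofracB. Qed.
Lemma to_loc_monoid : monoid_morphism to_loc.
Proof. by split=> [|a b]; apply: val_inj; rewrite /= ?tofracM. Qed.
HB.instance Definition _ := GRing.isZmodMorphism.Build B loc to_loc to_loc_zmod.
HB.instance Definition _ :=
  GRing.isMonoidMorphism.Build B loc to_loc to_loc_monoid.

(* the ideal p B_p *)
Definition loc_ideal : {pred loc} :=
  fun x => `[< exists a s, [/\ a \in p, s \notin p & val x = a%:F / s%:F] >].

Lemma loc_ideal_numer x a s : x \in loc_ideal -> s \notin p ->
  val x = a%:F / s%:F -> a \in p.
Proof.
move=> /asboolP [b [t [bp tp ->]]] sp /eqP.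
rewrite eqr_div ?spec_neq0 // -!tofracM tofrac_eq => /eqP e.
have : b * s \in p by rewrite mulrC idealMr.
by rewrite e prime_idealrM (negPf tp) orbF.
Qed.

Lemma loc_ideal_closed : idealr_closed loc_ideal.
Proof.
split.
- by apply/asboolP; exists 0, 1; rewrite rpred0 spec1 tofrac0 mul0r.
- apply/negP=> /loc_ideal_numer /(_ spec1) H.
  by move: (H 1); rewrite idealr1 divff ?spec_neq0 ?spec1 //; move/(_ erefl).
- move=> c x y; have /asboolP [a [s [sp ec]]] := loc_valP c.
  move=> /asboolP [b [t [bp tp ex]]] /asboolP [d [u [dp up ey]]].
  apply/asboolP; exists (a * b * u + d * (s * t)), (s * t * u); split.
  + by rewrite rpredD // mulrC ?idealMr.
  + by rewrite !spec_mul.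
  + rewrite /= in ex ey *; rewrite ec ex ey mulf_div addf_div ?mulf_neq0 ?spec_neq0 //.
    by rewrite tofracD !tofracM.
Qed.

HB.instance Definition _ := isIdealr.Build loc loc_ideal loc_ideal_closed.

(* kappa(p) = B_p / p B_p *)
Definition resfield : Type := {ideal_quot loc_ideal}.
HB.instance Definition _ := GRing.ComNzRing.on resfield.

Definition loc_to_res : loc -> resfield := \pi_({ideal_quot loc_ideal}).
HB.instance Definition _ := GRing.RMorphism.on loc_to_res.

Definition to_res : B -> resfield := loc_to_res \o to_loc.
HB.instance Definition _ := GRing.RMorphism.on to_res.

Lemma to_res_eq0 b : (to_res b == 0) = (b \in p).
Proof.
rewrite /to_res /= -[0](rmorph0 loc_to_res).
rewrite /loc_to_res -Quotient.idealrBE subr0; apply/idP/idP => [H|bp].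
  by apply: (loc_ideal_numer H spec1); rewrite /= tofrac1 divr1.
by apply/asboolP; exists b, 1; rewrite bp spec1 /= tofrac1 divr1.
Qed.

Lemma resfieldP (x : resfield) :
  exists a s, s \notin p /\ x * to_res s = to_res a.
Proof.
elim/quotW: x => x; rewrite -/loc_to_res; have /asboolP [a [s [sp ex]]] := loc_valP x.
exists a, s.
split=> //; rewrite /to_res /= -rmorphM; congr loc_to_res; apply: val_inj => /=.
by rewrite ex divfK ?spec_neq0.
Qed.

Lemma resfield_inv_subproof (x : resfield) : x != 0 -> exists y, y * x == 1.
Proof.
have [a [s [sp e]]] := resfieldP x => x0.
have s0 : to_res s != 0 by rewrite to_res_eq0.
have ap : a \notin p.
  apply: contra x0; rewrite -to_res_eq0 -e => /eqP xs0.
  have [q] : exists q, to_res s * q = 1.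
    have q1 : (s%:F)^-1 \in loc_pred.
      by apply/asboolP; exists 1, s; rewrite tofrac1 mul1r.
    exists (loc_to_res (Loc q1)); rewrite /to_res /= -rmorphM -[RHS](rmorph1 loc_to_res).
    by congr loc_to_res; apply: val_inj; rewrite /= divff ?spec_neq0.
  by move=> sq; rewrite -[x]mulr1 -sq mulrA xs0 mul0r.
have q1 : s%:F / a%:F \in loc_pred by apply/asboolP; exists s, a.
have q2 : (a%:F)^-1 \in loc_pred.
  by apply/asboolP; exists 1, a; rewrite tofrac1 mul1r.
have e1 : loc_to_res (Loc q1) = loc_to_res (Loc q2) * to_res s.
  rewrite /to_res /= -rmorphM; congr loc_to_res; apply: val_inj => /=.
  by rewrite mulrC.
have e2 : loc_to_res (Loc q2) * to_res a = 1.
  rewrite /to_res /= -rmorphM -[RHS](rmorph1 loc_to_res); congr loc_to_res; apply: val_inj => /=.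
  by rewrite mulVf ?spec_neq0.
by exists (loc_to_res (Loc q1)); rewrite e1 -mulrA [_ * x]mulrC e e2.
Qed.

Definition resfield_inv (x : resfield) : resfield :=
  if @idP (x != 0) is ReflectT x0 then xchoose (resfield_inv_subproof x0)
  else 0.

Lemma resfield_mulV x : x != 0 -> resfield_inv x * x = 1.
Proof.
rewrite /resfield_inv; case: {-}_ / idP => // x0 _; apply/eqP.
exact: (xchooseP (resfield_inv_subproof x0)).
Qed.

Lemma resfield_inv0 : resfield_inv 0 = 0.
Proof. by rewrite /resfield_inv; case: {-}_ / idP => // x0; case/eqP: (x0). Qed.

HB.instance Definition _ :=
  GRing.ComNzRing_isField.Build resfield resfield_mulV resfield_inv0.

End Localization.

Section ResidueAlgebra.
Variables (k : fieldType) (B : domAlgType k) (p : Spec B).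
Implicit Types (c : k) (x : resfield p).

Definition resfield_scale c x : resfield p := to_res p c%:A * x.

Lemma resfield_scaleA c d x :
  resfield_scale c (resfield_scale d x) = resfield_scale (c * d) x.
Proof. by rewrite /resfield_scale mulrA -rmorphM -scalerAl mul1r scalerA. Qed.
Lemma resfield_scale1 : left_id 1 resfield_scale.
Proof. by move=> x; rewrite /resfield_scale scale1r rmorph1 mul1r. Qed.
Lemma resfield_scaleDr : right_distributive resfield_scale +%R.
Proof. by move=> c x y; rewrite /resfield_scale mulrDr. Qed.
Lemma resfield_scaleDl x : {morph resfield_scale^~ x : c d / c + d}.
Proof. by move=> c d; rewrite /resfield_scale scalerDl rmorphD mulrDl. Qed.

HB.instance Definition _ := GRing.Zmodule_isLmodule.Build k (resfield p)
  resfield_scaleA resfield_scale1 resfield_scaleDr resfield_scaleDl.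

Lemma resfield_scaleAl c x y : c *: (x * y) = c *: x * y.
Proof. exact: mulrA. Qed.

HB.instance Definition _ :=
  GRing.Lmodule_isLalgebra.Build k (resfield p) resfield_scaleAl.
HB.instance Definition _ :=
  GRing.Lalgebra_isComAlgebra.Build k (resfield p).

Lemma to_res_scalable : scalable (to_res p).
Proof.
move=> c b; have -> : c *: to_res p b = to_res p c%:A * to_res p b by [].
by rewrite -rmorphM -scalerAl mul1r.
Qed.
HB.instance Definition _ :=
  GRing.isScalable.Build k B (resfield p) *:%R (to_res p) to_res_scalable.

End ResidueAlgebra.

(* A (x)_k B : a list of pairs [:: (a_1, b_1); ...; (a_n, b_n)] stands for
   a_1 (x) b_1 + ... + a_n (x) b_n, and tens_eq is the congruence generated
   by commutativity and the k-bilinearity relations. *)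
Section Tensor.
Variables (k : fieldType) (A B : comAlgType k).
Local Notation T := (seq (A * B)).
Implicit Types (s t u : T) (a : A) (b : B).

Inductive tens_eq : T -> T -> Prop :=
| tens_refl s : tens_eq s s
| tens_sym s t : tens_eq s t -> tens_eq t s
| tens_trans s t u : tens_eq s t -> tens_eq t u -> tens_eq s u
| tens_catl s s' t : tens_eq s s' -> tens_eq (s ++ t) (s' ++ t)
| tens_catC s t : tens_eq (s ++ t) (t ++ s)
| tens_addl a a' b : tens_eq [:: (a + a', b)] [:: (a, b); (a', b)]
| tens_addr a b b' : tens_eq [:: (a, b + b')] [:: (a, b); (a, b')]
| tens_scale (c : k) a b : tens_eq [:: (c *: a, b)] [:: (a, c *: b)]
| tens_zero b : tens_eq [:: (0, b)] [::].

Definition tens_rel : rel T := fun s t => `[< tens_eq s t >].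

Lemma tens_rel_equiv : equiv_class_of tens_rel.
Proof.
split=> [s|s t|t s u].
- by apply/asboolP; exact: tens_refl.
- by apply/asboolP/asboolP; exact: tens_sym.
- move=> /asboolP st /asboolP tu; apply/asboolP; exact: tens_trans st tu.
Qed.

Canonical tens_equivrel := EquivRelPack tens_rel_equiv.
Canonical tens_encModRel := defaultEncModRel tens_rel.

Definition tens : Type := {eq_quot tens_rel}.
HB.instance Definition _ : EqQuotient T tens_rel tens := EqQuotient.on tens.
HB.instance Definition _ := Choice.on tens.

Definition to_tens s : tens := \pi_({eq_quot tens_rel}) s.

Lemma to_tensP s t : to_tens s = to_tens t <-> tens_eq s t.
Proof.
split=> [/eqP|st]; first by rewrite /to_tens eqmodE => /asboolP.
by apply/eqP; rewrite /to_tens eqmodE; apply/asboolP.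
Qed.

Lemma to_tensK (x : tens) : to_tens (repr x) = x.
Proof. exact: reprK. Qed.

Lemma tens_cat s s' t t' :
  tens_eq s s' -> tens_eq t t' -> tens_eq (s ++ t) (s' ++ t').
Proof.
move=> ss tt; apply: tens_trans (tens_catl t ss) _.
apply: tens_trans (tens_catC _ _) _; apply: tens_trans (tens_catl _ tt) _.
exact: tens_catC.
Qed.

Lemma tens_perm s t : perm_eq s t -> tens_eq s t.
Proof.
elim: s t => [|x s IH] t.
  by rewrite perm_sym => /perm_nilP ->; exact: tens_refl.
move=> st; have xt : x \in t by rewrite -(perm_mem st) mem_head.
have [t1 [t2 e]] : exists t1 t2, t = t1 ++ x :: t2.
  by case/splitPr: xt => t1 t2; exists t1, t2.
rewrite e; apply: (@tens_trans _ (x :: t2 ++ t1)); last first.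
  exact: (@tens_catC (x :: t2) t1).
apply: (@tens_cat [:: x] [:: x] s (t2 ++ t1)); first exact: tens_refl.
apply: IH; rewrite -(perm_cons x) (perm_trans st) // e.
by rewrite perm_catC.
Qed.

(* Reduces compatibility statements to the bilinearity relations. *)
Lemma tens_lift_ind (V : Type) (R : V -> V -> Prop) (op : V -> V -> V)
    (F : T -> V) :
  (forall v, R v v) -> (forall v w, R v w -> R w v) ->
  (forall v w z, R v w -> R w z -> R v z) ->
  (forall v w z, R v w -> R (op v z) (op w z)) ->
  (forall v w, R (op v w) (op w v)) ->
  (forall s t, R (F (s ++ t)) (op (F s) (F t))) ->
  (forall a a' b, R (F [:: (a + a', b)]) (F [:: (a, b); (a', b)])) ->
  (forall a b b', R (F [:: (a, b + b')]) (F [:: (a, b); (a, b')])) ->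
  (forall c a b, R (F [:: (c *: a, b)]) (F [:: (a, c *: b)])) ->
  (forall b, R (F [:: (0, b)]) (F [::])) ->
  forall s t, tens_eq s t -> R (F s) (F t).
Proof.
move=> r sy tr cl cC Fc Fl Fr Fs Fz s t.
elim=> {s t} [s|s t _|s t u _ st _|s s' t _ ss|s t| | | |] //.
- exact: sy.
- exact: tr.
- by apply: (tr _ _ _ (Fc _ _)); apply: (tr _ _ _ (cl _ _ _ ss)); apply/sy/Fc.
- by apply: (tr _ _ _ (Fc _ _)); apply: (tr _ _ _ (cC _ _)); apply/sy/Fc.
Qed.

Lemma repr_tens s : tens_eq (repr (to_tens s)) s.
Proof. by apply/to_tensP; rewrite to_tensK. Qed.

Lemma tens_map1 (f g : A * B -> A * B) s :
  (forall x, tens_eq [:: f x] [:: g x]) -> tens_eq (map f s) (map g s).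
Proof.
move=> fg; elim: s => [|x s IH] /=; first exact: tens_refl.
exact: (@tens_cat [:: f x] [:: g x]).
Qed.

Lemma tens_map2 (f g h : A * B -> A * B) s :
  (forall x, tens_eq [:: f x] [:: g x; h x]) ->
  tens_eq (map f s) (map g s ++ map h s).
Proof.
move=> fgh; elim: s => [|x s IH] /=; first exact: tens_refl.
apply: (tens_trans (@tens_cat [:: f x] _ _ _ (fgh x) IH)).
apply: tens_perm => /=; rewrite perm_cons -cat_cons.
by rewrite perm_sym perm_catC /= perm_cons perm_catC.
Qed.

Lemma tens_map0 (f : A * B -> A * B) s :
  (forall x, tens_eq [:: f x] [::]) -> tens_eq (map f s) [::].
Proof.
move=> f0; elim: s => [|x s IH] /=; first exact: tens_refl.
exact: (@tens_cat [:: f x] [::]).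
Qed.

Lemma tens_lin_compat (F : T -> T) :
  (forall s t, F (s ++ t) = F s ++ F t) ->
  (forall a a' b, tens_eq (F [:: (a + a', b)]) (F [:: (a, b); (a', b)])) ->
  (forall a b b', tens_eq (F [:: (a, b + b')]) (F [:: (a, b); (a, b')])) ->
  (forall c a b, tens_eq (F [:: (c *: a, b)]) (F [:: (a, c *: b)])) ->
  (forall b, tens_eq (F [:: (0, b)]) (F [::])) ->
  forall s t, tens_eq s t -> tens_eq (F s) (F t).
Proof.
move=> Fc; apply: (@tens_lift_ind _ _ cat).
- exact: tens_refl.
- exact: tens_sym.
- exact: tens_trans.
- by move=> *; exact: tens_catl.
- exact: tens_catC.
- by move=> *; rewrite Fc; exact: tens_refl.
Qed.

Definition tadd (x y : tens) := to_tens (repr x ++ repr y).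
Definition tzero := to_tens [::].
Definition tneg s : T := [seq (- x.1, x.2) | x <- s].
Definition topp (x : tens) := to_tens (tneg (repr x)).

Lemma tadd_to s t : tadd (to_tens s) (to_tens t) = to_tens (s ++ t).
Proof. by apply/to_tensP; apply: tens_cat; exact: repr_tens. Qed.

Lemma tneg_compat s t : tens_eq s t -> tens_eq (tneg s) (tneg t).
Proof.
apply: tens_lin_compat => [s' t'|a a' b|a b b'|c a b|b]; rewrite /tneg.
- exact: map_cat.
- by rewrite /= opprD; exact: tens_addl.
- exact: tens_addr.
- by rewrite /= -scalerN; exact: tens_scale.
- by rewrite /= oppr0; exact: tens_zero.
Qed.

Lemma topp_to s : topp (to_tens s) = to_tens (tneg s).
Proof. by apply/to_tensP/tneg_compat; exact: repr_tens. Qed.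

Lemma tens_ind (P : tens -> Prop) : (forall s, P (to_tens s)) -> forall x, P x.
Proof. by move=> Ps x; rewrite -[x]to_tensK. Qed.

Lemma taddA : associative tadd.
Proof.
elim/tens_ind=> s; elim/tens_ind=> t; elim/tens_ind=> u.
by rewrite !tadd_to catA.
Qed.
Lemma taddC : commutative tadd.
Proof.
elim/tens_ind=> s; elim/tens_ind=> t; rewrite !tadd_to.
exact/to_tensP/tens_catC.
Qed.
Lemma tadd0 : left_id tzero tadd.
Proof. by elim/tens_ind=> s; rewrite tadd_to. Qed.
Lemma taddN : left_inverse tzero topp tadd.
Proof.
elim/tens_ind=> s; rewrite topp_to tadd_to; apply/to_tensP.
have {2}-> : s = map id s by rewrite map_id.
apply: tens_trans (tens_sym (@tens_map2 (fun x => (0, x.2)) _ _ _ _)) _.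
  by move=> [a b] /=; rewrite -[0](addNr a); exact: tens_addl.
by apply: tens_map0 => x; exact: tens_zero.
Qed.

HB.instance Definition _ := GRing.isZmodule.Build tens taddA taddC tadd0 taddN.

Lemma to_tensD s t : to_tens (s ++ t) = to_tens s + to_tens t.
Proof. by rewrite -tadd_to. Qed.

Definition tmulT s t : T := [seq (x.1 * y.1, x.2 * y.2) | x <- s, y <- t].
Definition tmul (x y : tens) := to_tens (tmulT (repr x) (repr y)).
Definition tone := to_tens [:: (1, 1)].

Lemma tmulT_cat s t u : tmulT (s ++ t) u = tmulT s u ++ tmulT t u.
Proof. exact: allpairs_cat. Qed.

Lemma tmulT1 x t : tmulT [:: x] t = [seq (x.1 * y.1, x.2 * y.2) | y <- t].
Proof. by rewrite /tmulT /= cats0. Qed.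

Lemma tmulT_compatl s t u : tens_eq s t -> tens_eq (tmulT s u) (tmulT t u).
Proof.
have c2 x y : tmulT [:: x; y] u = tmulT [:: x] u ++ tmulT [:: y] u.
  exact: (tmulT_cat [:: x] [:: y]).
apply: (tens_lin_compat (F := tmulT^~ u)) => [s' t'|a a' b|a b b'|c a b|b].
- exact: tmulT_cat.
- rewrite c2 !tmulT1; apply: tens_map2 => y /=.
  by rewrite mulrDl; exact: tens_addl.
- rewrite c2 !tmulT1; apply: tens_map2 => y /=.
  by rewrite mulrDl; exact: tens_addr.
- rewrite !tmulT1; apply: tens_map1 => y /=.
  by rewrite -!scalerAl; exact: tens_scale.
- rewrite !tmulT1; apply: tens_map0 => y /=.
  by rewrite mul0r; exact: tens_zero.
Qed.

Lemma tmulTC s t : tens_eq (tmulT s t) (tmulT t s).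
Proof.
apply: tens_perm; elim: s => [|x s IH]; first by rewrite /tmulT allpairs0r.
rewrite perm_sym /tmulT (perm_allpairs_consr _ _ (fun=> x) (fun=> s)) /=.
rewrite perm_sym perm_cat // (_ : map _ t = [seq (y.1 * x.1, y.2 * x.2) | y <- t]) //.
by apply: eq_map => y; rewrite mulrC [x.2 * _]mulrC.
Qed.

Lemma tmul_to s t : tmul (to_tens s) (to_tens t) = to_tens (tmulT s t).
Proof.
apply/to_tensP; apply: tens_trans (tmulT_compatl _ (repr_tens s)) _.
apply: tens_trans (tmulTC _ _) _.
by apply: tens_trans (tmulT_compatl _ (repr_tens t)) _; exact: tmulTC.
Qed.

Lemma tmulT_cons x s t :
  tmulT (x :: s) t = [seq (x.1 * y.1, x.2 * y.2) | y <- t] ++ tmulT s t.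
Proof. by []. Qed.

Lemma tmulTA s t u : tmulT s (tmulT t u) = tmulT (tmulT s t) u.
Proof.
elim: s => // x s IH; rewrite 2!tmulT_cons tmulT_cat IH; congr cat.
elim: t {IH} => // y t IH; rewrite tmulT_cons map_cat IH map_cons tmulT_cons.
congr cat; rewrite -map_comp; apply: eq_map => z /=.
by rewrite !mulrA.
Qed.

Lemma tmulA : associative tmul.
Proof.
elim/tens_ind=> s; elim/tens_ind=> t; elim/tens_ind=> u.
by rewrite !tmul_to tmulTA.
Qed.
Lemma tmulC : commutative tmul.
Proof.
elim/tens_ind=> s; elim/tens_ind=> t; rewrite !tmul_to.
exact/to_tensP/tmulTC.
Qed.
Lemma tmul1 : left_id tone tmul.
Proof.
elim/tens_ind=> s; rewrite tmul_to tmulT1; congr to_tens.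
by rewrite -[RHS]map_id; apply: eq_map => -[a b] /=; rewrite !mul1r.
Qed.
Lemma tmulD : left_distributive tmul +%R.
Proof.
elim/tens_ind=> s; elim/tens_ind=> t; elim/tens_ind=> u.
by rewrite -to_tensD !tmul_to tmulT_cat to_tensD.
Qed.

HB.instance Definition _ :=
  GRing.Zmodule_isComPzRing.Build tens tmulA tmulC tmul1 tmulD.

Lemma to_tensM s t : to_tens (tmulT s t) = to_tens s * to_tens t.
Proof. by rewrite -tmul_to. Qed.

Definition tscT a s : T := [seq (a * x.1, x.2) | x <- s].
Definition tscale a (x : tens) := to_tens (tscT a (repr x)).

Lemma tscale_to a s : tscale a (to_tens s) = to_tens (tscT a s).
Proof.
apply/to_tensP; move: (repr_tens s); move: (repr _) => t.
apply: tens_lin_compat => [s' t'|a1 a2 b|a1 b b'|c a1 b|b]; rewrite /tscT.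
- exact: map_cat.
- by rewrite /= mulrDr; exact: tens_addl.
- exact: tens_addr.
- by rewrite /= -scalerAr; exact: tens_scale.
- by rewrite /= mulr0; exact: tens_zero.
Qed.

Lemma tscaleA a a' x : tscale a (tscale a' x) = tscale (a * a') x.
Proof.
elim/tens_ind: x => s; rewrite !tscale_to /tscT -map_comp; congr to_tens.
by apply: eq_map => y /=; rewrite mulrA.
Qed.
Lemma tscale1 : left_id 1 tscale.
Proof.
elim/tens_ind=> s; rewrite tscale_to; congr to_tens.
by rewrite -[RHS]map_id; apply: eq_map => -[a b] /=; rewrite mul1r.
Qed.
Lemma tscaleDr : right_distributive tscale +%R.
Proof.
move=> a; elim/tens_ind=> s; elim/tens_ind=> t.
by rewrite -to_tensD !tscale_to /tscT map_cat to_tensD.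
Qed.
Lemma tscaleDl x : {morph tscale^~ x : a a' / a + a'}.
Proof.
elim/tens_ind: x => s a a'; rewrite !tscale_to -to_tensD.
by apply/to_tensP/tens_map2 => x; rewrite mulrDl; exact: tens_addl.
Qed.

HB.instance Definition _ := GRing.Zmodule_isLmodule.Build A tens
  tscaleA tscale1 tscaleDr tscaleDl.

Lemma to_tensZ a s : to_tens (tscT a s) = a *: to_tens s.
Proof. by rewrite -tscale_to. Qed.

Lemma tens_scaleAl a (x y : tens) : a *: (x * y) = a *: x * y.
Proof.
elim/tens_ind: x => s; elim/tens_ind: y => t.
rewrite -to_tensM -!to_tensZ -to_tensM; congr to_tens; elim: s => // x s IH.
rewrite tmulT_cons [tscT a (_ ++ _)]map_cat -!/(tscT _ _) IH.
rewrite -[tscT a (x :: s)]/((a * x.1, x.2) :: tscT a s) tmulT_cons.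
congr cat; rewrite /tscT -map_comp; apply: eq_map => y /=.
by rewrite mulrA.
Qed.

Definition ptens a b : tens := to_tens [:: (a, b)].

Lemma to_tens_sum s : to_tens s = \sum_(x <- s) ptens x.1 x.2.
Proof.
elim: s => [|x s IH]; first by rewrite big_nil.
by rewrite big_cons -IH -to_tensD; case: x.
Qed.

(* The additive map A (x)_k B -> V sending a (x) b to f a b, for f biadditive
   and k-balanced *)
Section Lift.
Variables (V : zmodType) (f : A -> B -> V).

Definition tens_lift (x : tens) : V := \sum_(y <- repr x) f y.1 y.2.

Definition tens_balanced : Prop :=
  [/\ forall a a' b, f (a + a') b = f a b + f a' b,
      forall a b b', f a (b + b') = f a b + f a b' &
      forall (c : k) a b, f (c *: a) b = f a (c *: b)].

Hypothesis f_bal : tens_balanced.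

Lemma tens_lift_to s : tens_lift (to_tens s) = \sum_(y <- s) f y.1 y.2.
Proof.
have [fDl fDr fZ] := f_bal; rewrite /tens_lift.
have := repr_tens s; move: (repr _) => t.
apply: (@tens_lift_ind _ eq +%R (fun s => \sum_(y <- s) f y.1 y.2)) => //=.
- by move=> u v w -> ->.
- by move=> u v w ->.
- exact: addrC.
- by move=> u v; rewrite big_cat.
- by move=> a a' b; rewrite !big_cons !big_nil !addr0 fDl.
- by move=> a b b'; rewrite !big_cons !big_nil !addr0 fDr.
- by move=> c a b; rewrite !big_cons !big_nil !addr0 fZ.
move=> b; rewrite big_cons big_nil addr0 /=.
by apply: (addrI (f 0 b)); rewrite -fDl !addr0.
Qed.

Lemma tens_lift_ptens a b : tens_lift (ptens a b) = f a b.
Proof. by rewrite tens_lift_to big_seq1. Qed.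

Lemma tens_lift_zmod : zmod_morphism tens_lift.
Proof.
have liftD x y : tens_lift (x + y) = tens_lift x + tens_lift y.
  elim/tens_ind: x => s; elim/tens_ind: y => t.
  by rewrite -to_tensD !tens_lift_to big_cat.
by move=> x y; apply: (addIr (tens_lift y)); rewrite -liftD !subrK.
Qed.

End Lift.

End Tensor.

Section ResidueTensor.
Variables (k : fieldType) (B : domAlgType k) (p : Spec B).

(* kappa(p) (x)_k B *)
Definition ktens : Type := tens (resfield p : comAlgType k) B.
HB.instance Definition _ := GRing.ComPzRing.on ktens.
HB.instance Definition _ := GRing.Lmodule.on ktens.

Lemma mul_to_res_balanced :
  tens_balanced (fun (a : resfield p : comAlgType k) b => a * to_res p b).
Proof.
split=> [a a' b|a b b'|c a b]; first exact: mulrDl.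
  by rewrite rmorphD mulrDr.
by rewrite linearZ -scalerAl -scalerAr.
Qed.

Lemma ktens_1_neq0 : 1 != 0 :> ktens.
Proof.
apply/eqP=> /(congr1 (tens_lift (fun (a : resfield p : comAlgType k) b =>
  a * to_res p b))).
rewrite (tens_lift_ptens mul_to_res_balanced).
rewrite (tens_lift_to mul_to_res_balanced) big_nil rmorph1 mulr1.
exact/eqP/oner_neq0.
Qed.

HB.instance Definition _ :=
  GRing.PzSemiRing_isNonZero.Build ktens ktens_1_neq0.
HB.instance Definition _ := GRing.Lmodule_isLalgebra.Build (resfield p) ktens
  (@tens_scaleAl k (resfield p) B).
HB.instance Definition _ := GRing.Lalgebra_isComAlgebra.Build (resfield p) ktens.

End ResidueTensor.

Section EmbeddingLocus.
Variables (k : fieldType) (B : domAlgType k).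

Definition embeds_in_poly (p : Spec B) (n : nat) : Prop :=
  exists f : {lrmorphism ktens p -> {mpoly (resfield p)[n]}}, injective f.

(* X_k(B) *)
Definition Xset (p : Spec B) : Prop := exists n, embeds_in_poly p n.

End EmbeddingLocus.

(* D is not assumed k-linear: over a field k of characteristic zero this is
   automatic on a k-domain, see lnd_scalar and lndZ below. *)
Record lnd (B : nzRingType) := Lnd {
  lnd_fun :> {additive B -> B};
  lnd_leibniz : forall a b, lnd_fun (a * b) = lnd_fun a * b + a * lnd_fun b;
  lnd_nilp : forall a, exists n, iter n lnd_fun a = 0
}.

Definition frac_ker (B : idomainType) (D : lnd B) (x : {fraction B}) : Prop :=
  exists a b, [/\ D a = 0, D b = 0, b != 0 & x = a%:F / b%:F].

Definition KDelta (B : idomainType) (Delta : lnd B -> Prop)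
    (x : {fraction B}) : Prop :=
  forall D, Delta D -> frac_ker D x.

Definition FML (B : idomainType) : {fraction B} -> Prop :=
  KDelta (fun _ : lnd B => True).

(* the image of k in Frac B *)
Definition scalars (k : fieldType) (B : domAlgType k) (x : {fraction B}) : Prop :=
  exists c : k, x = (c%:A)%:F.

Definition same_set (T : Type) (X Y : T -> Prop) : Prop :=
  forall x, X x <-> Y x.

Section LndTheory.
Variables (k : fieldType) (B : domAlgType k) (D : lnd B).
Hypothesis k0 : [pchar k] =i pred0.
Implicit Types (a b : B) (m n : nat).

Lemma iter_lnd0 n : iter n D 0 = 0.
Proof. by elim: n => //= n ->; rewrite raddf0. Qed.

Lemma iter_lndD n : {morph iter n D : a b / a + b}.
Proof. by elim: n => // n IH a b; rewrite /= IH raddfD. Qed.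

Lemma iter_lnd_le m n a : (m <= n)%N -> iter m D a = 0 -> iter n D a = 0.
Proof. by move=> /subnK <- H; rewrite iterD H iter_lnd0. Qed.

Lemma lnd_leading N m n a b : (m + n = N)%N ->
  iter m.+1 D a = 0 -> iter n.+1 D b = 0 ->
  iter N D (a * b) = (iter m D a * iter n D b) *+ 'C(N, m).
Proof.
elim: N m n a b => [|N IH] [|m] [|n] a b // mnN am bn; rewrite ?mulr1n //.
- case: mnN => mnN; rewrite {}mnN in bn *.
  rewrite iterSr lnd_leibniz (_ : D a = 0) // mul0r add0r.
  by rewrite (IH 0%N N) // ?bin0 -?iterSr.
- case: mnN => mnN; rewrite addn0 in mnN; rewrite {}mnN in am *.
  rewrite iterSr lnd_leibniz (_ : D b = 0) // mulr0 addr0.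
  by rewrite (IH N 0%N) ?addn0 ?binn -?iterSr.
- case: mnN => mnN; rewrite iterSr lnd_leibniz iter_lndD.
  rewrite (IH m n.+1) -?iterSr // (IH m.+1 n) -?iterSr //; last first.
    by rewrite addSnnS.
  by rewrite -mulrnDr addnC -binS.
Qed.

Lemma lnd1 : D 1 = 0.
Proof.
have := lnd_leibniz D 1 1; rewrite !mulr1 mul1r => e.
by apply: (addrI (D 1)); rewrite -e addr0.
Qed.

Lemma lnd_order a : a != 0 -> exists m, iter m D a != 0 /\ iter m.+1 D a = 0.
Proof.
move=> a0; have ex : exists n, iter n D a == 0.
  by have [n /eqP] := lnd_nilp D a; exists n.
case: (ex_minnP ex) => -[|m] /eqP nm lt; first by rewrite -nm /= eqxx in a0.
exists m; split=> //; apply/negP => /lt; by rewrite ltnn.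
Qed.

Lemma lnd_scalar (c : k) : D c%:A = 0.
Proof.
have [->|c0] := eqVneq c 0; first by rewrite scale0r raddf0.
have cV : c%:A * (c^-1)%:A = 1 :> B.
  by rewrite -scalerAl mul1r scalerA divff // scale1r.
have [m [am am1]] : exists m, iter m D c%:A != 0 /\ iter m.+1 D c%:A = 0.
  by apply: lnd_order; rewrite scaler_eq0 negb_or c0 oner_neq0.
have [n [bn bn1]] :
    exists n, iter n D (c^-1)%:A != 0 /\ iter n.+1 D (c^-1)%:A = 0.
  by apply: lnd_order; rewrite scaler_eq0 negb_or invr_neq0 ?oner_neq0.
have := lnd_leading (erefl (m + n)%N) am1 bn1; rewrite cV.
case: m am am1 => [|m] am am1 // /eqP; rewrite addSn iterSr lnd1 iter_lnd0.
rewrite eq_sym -mulr_natr !mulf_eq0 (negPf am) (negPf bn) /=.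
rewrite -[X in X%:R]/('C((m + n).+1, m.+1)) -(rmorph_nat (in_alg B)) /=.
rewrite scaler_eq0 oner_eq0 orbF.
by rewrite (iffLR (pcharf0P k) k0) -leqn0 leqNgt bin_gt0 -addSn leq_addr.
Qed.

Lemma lndZ (c : k) b : D (c *: b) = c *: D b.
Proof. by rewrite -mulr_algl lnd_leibniz lnd_scalar mul0r add0r mulr_algl. Qed.

Lemma iter_lndZ n (c : k) b : iter n D (c *: b) = c *: iter n D b.
Proof. by elim: n => // n IH; rewrite /= IH lndZ. Qed.

End LndTheory.

Section Psi.
Variables (k : fieldType) (B : domAlgType k) (N : nat) (S : N.-tuple (lnd B)).
Implicit Types (m : 'X_{1..N}) (b : B).

(* (D_N^{m_N} o ... o D_1^{m_1}) (b), with D_(j+1) = tnth S j *)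
Definition iter_lnds m (s : seq 'I_N) b : B :=
  foldl (fun x j => iter (m j) (tnth S j) x) b s.

Definition Psi_coef m b : B :=
  ((\prod_(j < N) (m j)`!)%:R : k)^-1 *: iter_lnds m (enum 'I_N) b.

Lemma iter_lnds_cons m j s b :
  iter_lnds m (j :: s) b = iter_lnds m s (iter (m j) (tnth S j) b).
Proof. by []. Qed.

Lemma iter_lnds0 m s : iter_lnds m s 0 = 0.
Proof. by elim: s => // j s; rewrite iter_lnds_cons iter_lnd0. Qed.

Lemma iter_lndsD m s : {morph iter_lnds m s : a b / a + b}.
Proof. by elim: s => // j s IH a b; rewrite !iter_lnds_cons iter_lndD IH. Qed.

Lemma iter_lnds_finite s b : exists d, forall m,
  (exists2 j, j \in s & (d <= m j)%N) -> iter_lnds m s b = 0.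
Proof.
elim: s b => [|i s IH] b; first by exists 0%N => m [].
have [n bn] := lnd_nilp (tnth S i) b.
have [d dP] : exists d, forall l, (l < n)%N -> forall m,
    (exists2 j, j \in s & (d <= m j)%N) ->
    iter_lnds m s (iter l (tnth S i) b) = 0.
  elim: n {bn} => [|n [d dP]]; first by exists 0%N.
  have [d' dP'] := IH (iter n (tnth S i) b).
  exists (maxn d d') => l; rewrite ltnS leq_eqVlt => /predU1P [->|ln] m [j js];
    rewrite geq_max => /andP [dj dj'].
    by apply: dP'; exists j.
  by apply: dP => //; exists j.
exists (maxn n d) => m [j jis]; rewrite geq_max => /andP [nj dj].
rewrite iter_lnds_cons.
have [ni|ni] := leqP n (m i); first by rewrite (iter_lnd_le ni bn) iter_lnds0.
apply: dP => //; exists j => //; move: jis; rewrite inE => /predU1P [e|//].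
by rewrite e leqNgt ni in nj.
Qed.

Lemma Psi_finite b : exists d, forall m, (d <= mdeg m)%N -> Psi_coef m b = 0.
Proof.
have [d dP] := iter_lnds_finite (enum 'I_N) b.
exists (N * d).+1 => m dm; rewrite /Psi_coef dP ?scaler0 //.
have /existsP [j dj] : [exists j, (d <= m j)%N].
  apply: contraLR dm; rewrite negb_exists => /forallP H.
  rewrite -ltnNge ltnS mdegE -[X in (_ <= X * _)%N]card_ord -sum_nat_const.
  by apply: leq_sum => j _; have := H j; rewrite -ltnNge => /ltnW.
by exists j; rewrite ?mem_enum.
Qed.

Definition Psi_bound b : nat := projT1 (cid (Psi_finite b)).

(* The sum over N^N only has finitely many nonzero terms (Psi_finite). *)
Definition Psi b : {mpoly B[N]} :=
  \sum_(m : 'X_{1..N < Psi_bound b}) Psi_coef m b *: 'X_[m].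

Lemma mcoeff_Psi b m : (Psi b)@_m = Psi_coef m b.
Proof.
have [lt|le] := ltnP (mdeg m) (Psi_bound b).
  by rewrite (mcoeff_mpoly (fun m => Psi_coef m b)).
rewrite [RHS](projT2 (cid (Psi_finite b))) // raddf_sum big1 // => i _.
rewrite /= mcoeffZ mcoeffX; case: eqP => [e|_]; last by rewrite mulr0.
by have := bmdeg i; rewrite e ltnNge le.
Qed.

Definition Psi_at (p : Spec B) b : {mpoly (resfield p)[N]} :=
  map_mpoly (to_res p) (Psi b).

Lemma mcoeff_Psi_at (p : Spec B) b m :
  (Psi_at p b)@_m = to_res p (Psi_coef m b).
Proof. by rewrite -mcoeff_Psi; exact: mcoeff_map_mpoly. Qed.

(* lambda (x) b |-> lambda * Psi_at p b *)
Definition hatPsi (p : Spec B) : ktens p -> {mpoly (resfield p)[N]} :=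
  tens_lift (fun (a : resfield p : comAlgType k) b => a *: Psi_at p b).

Lemma PsiD : {morph Psi : a b / a + b}.
Proof.
move=> a b; apply/mpolyP => m; rewrite mcoeffD !mcoeff_Psi /Psi_coef.
by rewrite iter_lndsD scalerDr.
Qed.

Section Char0.
Hypothesis k0 : [pchar k] =i pred0.

Lemma iter_lndsZ m s (c : k) b : iter_lnds m s (c *: b) = c *: iter_lnds m s b.
Proof. by elim: s b => // j s IH b; rewrite !iter_lnds_cons iter_lndZ // IH. Qed.

Lemma PsiZ (c : k) b : Psi (c *: b) = c%:A *: Psi b.
Proof.
apply/mpolyP => m; rewrite mcoeffZ !mcoeff_Psi /Psi_coef iter_lndsZ.
by rewrite mulr_algl !scalerA mulrC.
Qed.

Lemma hatPsi_balanced (p : Spec B) :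
  tens_balanced (fun (a : resfield p : comAlgType k) b => a *: Psi_at p b).
Proof.
split=> [a a' b|a b b'|c a b]; first exact: scalerDl.
  by rewrite /Psi_at PsiD rmorphD scalerDr.
have -> : Psi_at p (c *: b) = to_res p c%:A *: Psi_at p b.
  apply/mpolyP => m; rewrite mcoeff_Psi_at mcoeffZ mcoeff_Psi_at.
  by rewrite -(rmorphM (to_res p)) -mcoeff_Psi PsiZ mcoeffZ mcoeff_Psi.
rewrite scalerA; congr (_ *: _).
by rewrite rmorph_alg mulrC mulr_algl.
Qed.

Lemma hatPsi_ptens (p : Spec B) (a : resfield p) b :
  hatPsi (ptens (a : (resfield p : comAlgType k)) b : ktens p) = a *: Psi_at p b.
Proof. exact: tens_lift_ptens (hatPsi_balanced p) a b. Qed.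

Lemma hatPsi_zmod (p : Spec B) : zmod_morphism (@hatPsi p).
Proof. exact: tens_lift_zmod (hatPsi_balanced p). Qed.

Lemma hatPsi_scalable (p : Spec B) : scalable (@hatPsi p).
Proof.
move=> a x; have fB := hatPsi_balanced p; rewrite /hatPsi.
elim/tens_ind: x => s; rewrite -[a *: _]to_tensZ !(tens_lift_to fB).
rewrite big_map scaler_sumr; apply: eq_bigr => y _ /=.
by rewrite scalerA.
Qed.

End Char0.
End Psi.

(* Main.v *)
From HB Require Import structures.
Require Import Defs.
From mathcomp Require Import all_boot all_algebra.
From mathcomp Require Import mpoly boolp ring.
From mathcomp Require classical_sets.

Set Implicit Arguments.
Unset Strict Implicit.
Unset Printing Implicit Defensive.

Import GRing.Theory.
Local Open Scope ring_scope.

(** Why the theorem holds.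

    Fix a transcendence basis b_1, ..., b_d of B over k. Everything that
    happens at a prime p is controlled by one question: are the polynomials
    Psi^p(b_1), ..., Psi^p(b_d) algebraically independent over kappa(p)?

    Suppose that they are. As B is algebraic over k[b], the map Psi^p is
    injective on B, and so is the one attached to any longer sequence D :: S.
    Setting the first variable to 0 turns the longer map into the shorter one
    without losing the independence, so it is injective on everything algebraic
    over the images of the b_i. Hence each kappa(p)-linear relation
    \sum_i c_i Psi^p(x_i) = 0 already holds for D :: S, and the coefficient of
    the first variable gives \sum_i c_i Psi^p(D x_i) = 0
    (relations_stable). Now take a shortest nontrivial relation whose c_i are
    linearly independent over k. The shorter relation between the
    x_1 D x_i - x_i D x_1 must be trivial, for all D in Delta, so that every
    x_i / x_1 lies in K_Delta = k and the relation collapses to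
    c Psi^p(x_1) = 0, which is absurd (lin_disjoint). So the map
    kappa(p) (x) B -> kappa(p)[X] is injective. This is the
    usual descent argument for subspaces that are stable under derivations.

    At the generic point, choose S so that as many as possible of the
    Psi(b_i) are independent. Maximality replaces independence of the whole
    basis in the argument above, so that the generic map is injective, and
    then all the Psi(b_i) are independent (generic_indep).

    To leave the generic point, complete the Psi(b_i) in B[X_1, ..., X_N] by
    some of the variables to a transcendence basis over B, and substitute
    integers for these. The d remaining variables are algebraic over the images
    of the Psi(b_i), as witnessed by polynomials whose leading coefficients stay
    nonzero at every prime that avoids a certain f != 0; by Steinitz exchange
    the d images are then independent (independence_spreads). This yields at
    once the open set D(f) of (b) and, by composition with the substitution,
    the embedding into d variables of (a).

    It remains that d is the Krull dimension. A strict inclusion of primes costs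
    at least one independent element, so chains have length at most d. For the
    converse, let y, s be a transcendence basis of B / p. For a suitable
    f = y g + 1 no nonzero element of k[s] is a multiple of f modulo p, hence
    some prime q contains p and f and avoids k[s] \ {0}; then s is a
    transcendence basis of B / q (extend_prime). *)

(** * Subrings generated by a sequence *)

Section Image.
Variables (R S : comNzRingType) (f : {rmorphism R -> S}).
Definition rimage : {pred S} := fun y => `[< exists x, y = f x >].
Lemma rimage_subring : subring_closed rimage.
Proof.
split=> [|_ _ /asboolP[x ->] /asboolP[y ->]|_ _ /asboolP[x ->] /asboolP[y ->]];
  apply/asboolP; [exists 1|exists (x - y)|exists (x * y)];
  by rewrite ?rmorph1 ?rmorphB ?rmorphM.
Qed.
HB.instance Definition _ := GRing.isSubringClosed.Build S rimage rimage_subring.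
Lemma rimageP y : reflect (exists x, y = f x) (y \in rimage).
Proof. exact: asboolP. Qed.
Lemma mem_rimage x : f x \in rimage.
Proof. by apply/rimageP; exists x. Qed.
End Image.

Section Adjoin.
Variables (R : comNzRingType) (A : subringClosed R) (x : R).
Definition adjoin : {pred R} :=
  fun y => `[< exists2 p, p \is a polyOver A & y = p.[x] >].
Lemma adjoinP y :
  reflect (exists2 p, p \is a polyOver A & y = p.[x]) (y \in adjoin).
Proof. exact: asboolP. Qed.
Lemma adjoin_subring : subring_closed adjoin.
Proof.
split=> [|_ _ /adjoinP[p Ap ->] /adjoinP[q Aq ->]|
  _ _ /adjoinP[p Ap ->] /adjoinP[q Aq ->]];
  apply/adjoinP; [exists 1|exists (p - q)|exists (p * q)];
  by rewrite ?rpred1 ?rpredB ?rpredM ?hornerE.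
Qed.
HB.instance Definition _ := GRing.isSubringClosed.Build R adjoin adjoin_subring.
Lemma adjoin_base a : a \in A -> a \in adjoin.
Proof. by move=> Aa; apply/adjoinP; exists a%:P;
  rewrite ?polyOverC ?hornerC. Qed.
Lemma adjoin_gen : x \in adjoin.
Proof. by apply/adjoinP; exists 'X; rewrite ?polyOverX ?hornerX. Qed.
Lemma adjoin_min (M : subringClosed R) :
  {subset A <= M} -> x \in M -> {subset adjoin <= M}.
Proof.
move=> AM Mx _ /adjoinP[p Ap ->]; apply: rpred_horner => //.
exact: polyOverS Ap.
Qed.
End Adjoin.

(** The subring A[s], as iterated simple extensions: its elements are then
    univariate polynomials over the previous stage, so that arguments on s run by
    induction without multivariate polynomials. *)
Fixpoint gen (R : comNzRingType) (A : subringClosed R) (s : seq R) :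
    subringClosed R :=
  if s is x :: s' then (adjoin (gen A s') x : subringClosed R) else A.

Section Gen.
Variables (R : comNzRingType) (A : subringClosed R).
Implicit Types (s t : seq R).
Lemma gen_base s : {subset A <= gen A s}.
Proof. by elim: s => // x s IH a /IH; apply: adjoin_base. Qed.
Lemma gen_mem s : {subset s <= gen A s}.
Proof.
elim: s => // x s IH y; rewrite inE => /predU1P[->|/IH];
  first exact: adjoin_gen.
exact: adjoin_base.
Qed.
Lemma gen_min s (M : subringClosed R) :
  {subset A <= M} -> {subset s <= M} -> {subset gen A s <= M}.
Proof.
move=> AM; elim: s => // x s IH sM; apply: adjoin_min; last exact/sM/mem_head.
by apply: IH => y ys; apply: sM; rewrite inE ys orbT.
Qed.
Lemma genS s t : {subset s <= t} -> {subset gen A s <= gen A t}.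
Proof. by move=> st; apply: gen_min => [|x /st]; [apply: gen_base|apply: gen_mem]. Qed.
End Gen.

(** * Integral and algebraic elements over a subring *)

Section SubringType.
Variables (R : comNzRingType) (A : subringClosed R).
(** A subring as a ring in its own right, the form in which the theory of
    integral elements over a ring morphism applies to it. *)
Record subring_of := SubringOf {subring_val : R; _ : subring_val \in A}.
HB.instance Definition _ := [isSub for subring_val].
HB.instance Definition _ := [Choice of subring_of by <:].
HB.instance Definition _ := [SubChoice_isSubComNzRing of subring_of by <:].
End SubringType.

Section Integral.
Variables (R : comNzRingType) (A : subringClosed R).
Definition integral (x : R) : Prop :=
  exists p, [/\ p \is a polyOver A, p \is monic & root p x].
Local Notation U := (subring_of A).
Let v : {rmorphism U -> R} := val.

Lemma polyOver_lift (p : {poly R}) : p \is a polyOver A ->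
  exists q : {poly U}, p = map_poly val q.
Proof.
move=> Ap; exists (\poly_(i < size p) insubd (0 : U) p`_i).
apply/polyP=> i; rewrite coef_map_id0 // coef_poly.
case: ltnP => [_|le]; last by rewrite raddf0 nth_default.
rewrite val_insubd; case: ifP => // /negP[]; exact: (polyOverP Ap).
Qed.

Lemma integralE x : integral x <-> integralOver (val : U -> R) x.
Proof.
split=> [[p [/polyOver_lift[q ->] mq rq]]|[q mq rq]].
  exists q => //; move: mq; rewrite !monicE.
  by rewrite (lead_coef_map_inj val_inj (raddf0 _)) -(rmorph1 v) => /eqP/val_inj->.
exists (map_poly val q); split=> //; last exact: monic_map.
by apply/polyOverP=> i; rewrite coef_map; apply: (valP q`_i).
Qed.

Lemma integral_base a : a \in A -> integral a.
Proof.
move=> Aa; exists ('X - a%:P); split; rewrite ?monicXsubC ?root_XsubC //.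
by rewrite polyOverXsubC.
Qed.
Definition int_closure : {pred R} := fun x => `[< integral x >].
Lemma int_closureP x : reflect (integral x) (x \in int_closure).
Proof. exact: asboolP. Qed.
Lemma int_closure_subring : subring_closed int_closure.
Proof.
split=> [|x y /int_closureP/integralE ix /int_closureP/integralE iy|
  x y /int_closureP/integralE ix /int_closureP/integralE iy]; apply/int_closureP.
- exact/integral_base/rpred1.
- exact/integralE/integral_sub.
- exact/integralE/integral_mul.
Qed.
HB.instance Definition _ := GRing.isSubringClosed.Build R int_closure int_closure_subring.
Lemma integral_trans p x :
  p \is a polyOver int_closure -> p \is monic -> root p x -> integral x.
Proof.
move=> Ap mp rp; apply/integralE; apply: integral_root_monic mp rp _.
by apply/integral_poly=> i; apply/integralE/int_closureP/(polyOverP Ap).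
Qed.
End Integral.

(** For a domain R this is algebraicity over the fraction field of A; staying
    inside R spares the passage to fractions. *)
Definition alg (R : comNzRingType) (A : subringClosed R) (x : R) : Prop :=
  exists p, [/\ p \is a polyOver A, p != 0 & root p x].

Section Algebraic.
Variables (R : idomainType) (A : subringClosed R).
Implicit Types (x y a c : R).

Lemma alg_sub (A' : subringClosed R) x : {subset A <= A'} -> alg A x -> alg A' x.
Proof. by move=> AA' [p [Ap p0 px]]; exists p; split=> //;
  apply: polyOverS Ap. Qed.

Lemma integral_alg x : integral A x -> alg A x.
Proof. by move=> [p [Ap mp px]]; exists p; split=> //; apply: monic_neq0. Qed.

(** With c the leading coefficient of an equation of degree n for x, the product
    by c^(n-1) is a monic equation for c x. This reduces the closure properties
    of algebraic elements to those of integral ones. *)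
Lemma alg_scaled_integral x : alg A x ->
  exists c, [/\ c \in A, c != 0 & integral A (c * x)].
Proof.
move=> [p [Ap p0 px]]; set c := lead_coef p.
have c0 : c != 0 by rewrite lead_coef_eq0.
have [n sp] : exists n, size p = n.+2.
  case e: (size p) => [|[|n]]; last by exists n.
    by move/eqP: e; rewrite size_poly_eq0 (negPf p0).
  have /size_poly1P[d d0 ep]: size p == 1%N by rewrite e.
  by move: px; rewrite ep rootE hornerC (negPf d0).
exists c; split=> //; first exact: (polyOverP Ap).
exists ('X^(n.+1) + \poly_(i < n.+1) (p`_i * c ^+ (n - i))); split.
- rewrite rpredD ?rpredX ?polyOverX //; apply/polyOver_poly => i _.
  by rewrite rpredM ?rpredX ?(polyOverP Ap).
- rewrite monicE lead_coefDl ?lead_coefXn // size_polyXn ltnS.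
  exact: size_poly.
- rewrite rootE hornerD hornerXn horner_poly.
  have -> : \sum_(i < n.+1) p`_i * c ^+ (n - i) * (c * x) ^+ i =
      c ^+ n * \sum_(i < n.+1) p`_i * x ^+ i.
    rewrite mulr_sumr; apply: eq_bigr => i _; rewrite exprMn.
    have -> : c ^+ n = c ^+ (n - i) * c ^+ i by rewrite -exprD subnK // -ltnS.
    by rewrite -!mulrA mulrCA; congr (_ * _); rewrite mulrCA.
  move: px; rewrite rootE horner_coef sp big_ord_recr /= => /eqP/(canRL (addrK _)).
  rewrite sub0r => ->.
  rewrite (_ : p`_n.+1 = c) ?exprMn; last by rewrite /c lead_coefE sp.
  by rewrite mulrN mulrA exprSr subrr.
Qed.

Lemma alg_unscale c x : c \in A -> c != 0 -> alg A (c * x) -> alg A x.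
Proof.
move=> Ac c0 [p [Ap p0 px]]; exists (p \Po (c *: 'X)); split.
- by rewrite polyOver_comp // polyOverZ ?polyOverX.
- by rewrite comp_poly_eq0 // size_scale // size_polyX.
- by rewrite rootE horner_comp !hornerE.
Qed.

Lemma alg_base a : a \in A -> alg A a.
Proof. by move/(integral_base)/integral_alg. Qed.

Definition alg_closure : {pred R} := fun x => `[< alg A x >].
Lemma alg_closureP x : reflect (alg A x) (x \in alg_closure).
Proof. exact: asboolP. Qed.

Lemma alg_closure_subring : subring_closed alg_closure.
Proof.
have op x y : alg A x -> alg A y ->
    exists c, [/\ c \in A, c != 0, integral A (c * x) & integral A (c * y)].
  move=> /alg_scaled_integral[c [Ac c0 icx]] /alg_scaled_integral[d [Ad d0 idy]].
  exists (c * d); split; rewrite ?rpredM ?mulf_neq0 //.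
    rewrite mulrAC; apply/int_closureP; rewrite rpredM //;
      apply/int_closureP => //.
    exact: integral_base.
  rewrite -mulrA; apply/int_closureP; rewrite rpredM //;
    apply/int_closureP => //.
  exact: integral_base.
split=> [|x y /alg_closureP ax /alg_closureP ay|x y /alg_closureP ax /alg_closureP ay];
  apply/alg_closureP; first exact/alg_base/rpred1.
- have [c [Ac c0 /int_closureP icx /int_closureP icy]] := op _ _ ax ay.
  apply: (alg_unscale Ac c0); apply/integral_alg/int_closureP.
  by rewrite mulrBr rpredB.
- have [c [Ac c0 /int_closureP icx /int_closureP icy]] := op _ _ ax ay.
  apply: (@alg_unscale (c * c)); rewrite ?rpredM ?mulf_neq0 //.
  by apply/integral_alg/int_closureP; rewrite mulrACA rpredM.
Qed.
HB.instance Definition _ :=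
  GRing.isSubringClosed.Build R alg_closure alg_closure_subring.

(** Dividing an equation of x <> 0 by powers of the variable. *)
Lemma alg_nonzero_const p x : p \is a polyOver A -> p != 0 -> root p x -> x != 0 ->
  exists q, [/\ q \is a polyOver A, q`_0 != 0 & root q x].
Proof.
move: {2}(size p) (leqnn (size p)) => n; elim: n p => [|n IH] p.
  by rewrite leqn0 size_poly_eq0 => ->.
move=> sp Ap p0 px x0; have [c0|c0] := eqVneq p`_0 0; last by exists p.
have /factor_theorem[q ep] : root p 0 by rewrite rootE horner_coef0 c0.
move: ep; rewrite subr0 => ep.
have q0 : q != 0 by apply: contra_neq p0 => q0; rewrite ep q0 mul0r.
apply: (IH q) => //.
- by move: sp; rewrite ep size_mulX.
- by apply/polyOverP=> i; have := polyOverP Ap i.+1; rewrite ep coefMX.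
- by move: px; rewrite ep rootE !hornerE mulf_eq0 (negPf x0) orbF.
Qed.

(** An algebraic l <> 0 has a multiple l' l that lies in A \ {0}, namely the
    constant term of an equation; so l x algebraic makes (l' l) x algebraic. *)
Lemma alg_unscale_alg l x : alg A l -> l != 0 -> alg A (l * x) -> alg A x.
Proof.
move=> al l0 alx; have [p [Ap p0 pl]] := al.
have [q [Aq q0 ql]] := alg_nonzero_const Ap p0 pl l0.
apply: (@alg_unscale q`_0) => //; first exact: (polyOverP Aq).
have [r er] : exists r, q = r * 'X + (q`_0)%:P.
  have /factor_theorem[r er] : root (q - (q`_0)%:P) 0.
    by rewrite rootE !hornerE horner_coef0 subrr.
  by exists r; rewrite -[q in LHS](subrK (q`_0)%:P) er subr0.
have Ar : r \is a polyOver alg_closure.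
  apply/polyOverP=> i; apply/alg_closureP/alg_base.
  by have := polyOverP Aq i.+1; rewrite er coefD coefMX coefC /= addr0.
have e : q`_0 = - (r.[l] * l).
  by apply/eqP; rewrite -addr_eq0 addrC; move: ql; rewrite {1}er rootE !hornerE.
apply/alg_closureP; rewrite e mulNr -mulrA rpredN rpredM //.
  by rewrite rpred_horner //; apply/alg_closureP.
exact/alg_closureP.
Qed.

End Algebraic.

(** After multiplication by a common c in A the coefficients of the equation are
    integral over A. Its leading coefficient l makes l x integral over integral
    elements, and l itself is algebraic and can be divided out. *)
Lemma alg_trans (R : idomainType) (A : subringClosed R) x :
  alg (alg_closure A) x -> alg A x.
Proof.
move=> [p [Ap p0 px]].
have [c [Ac c0 icp]] : exists c, [/\ c \in A, c != 0 &
    forall i, (i < size p)%N -> integral A (c * p`_i)].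
  move: (size p) => n; elim: n => [|n [c [Ac c0 icp]]].
    by exists 1; split; rewrite ?rpred1 ?oner_neq0.
  have /alg_closureP/alg_scaled_integral[d [Ad d0 idp]] := polyOverP Ap n.
  exists (d * c); split; rewrite ?rpredM ?mulf_neq0 // => i.
  rewrite ltnS leq_eqVlt => /predU1P[->|ilt].
    rewrite mulrAC mulrC; apply/int_closureP; rewrite rpredM //;
      apply/int_closureP => //.
    exact: integral_base.
  rewrite -mulrA; apply/int_closureP; rewrite rpredM //; apply/int_closureP.
    exact: integral_base.
  exact: icp.
pose q := c *: p.
have Aq : q \is a polyOver (int_closure A).
  apply/polyOverP=> i; rewrite coefZ; apply/int_closureP.
  have [/icp//|le] := ltnP i (size p).
  by rewrite nth_default // mulr0; apply/int_closureP/rpred0.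
have q0 : q != 0 by rewrite -size_poly_eq0 size_scale ?size_poly_eq0.
have aq : alg (int_closure A) x.
  by exists q; split=> //; rewrite rootE hornerZ (rootP px) mulr0.
have [l [il l0 [r [Ar mr rx]]]] := alg_scaled_integral aq.
have /integral_alg alx := integral_trans Ar mr rx.
apply: alg_unscale_alg l0 alx.
exact/integral_alg/int_closureP.
Qed.

Lemma alg_over_alg (R : idomainType) (A A' : subringClosed R) x :
  (forall a, a \in A' -> alg A a) -> alg A' x -> alg A x.
Proof. by move=> AA' ax; apply/alg_trans/alg_sub/ax => a /AA' ?;
  apply/alg_closureP. Qed.

Lemma alg_gen_trans (R : idomainType) (A A' : subringClosed R) s x :
  (forall a, a \in A -> alg A' a) -> (forall y, y \in s -> alg A' y) ->
  alg (gen A s) x -> alg A' x.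
Proof.
move=> AA' sA'; apply: alg_over_alg => a.
have AM : {subset A <= alg_closure A'} by move=> ? ?; apply/alg_closureP; auto.
have sM : {subset s <= alg_closure A'} by move=> ? ?; apply/alg_closureP; auto.
by move/(gen_min AM sM)/alg_closureP.
Qed.

Lemma gen_trans (R : idomainType) (A : subringClosed R) s t x :
  (forall y, y \in s -> alg (gen A t) y) ->
  alg (gen A s) x -> alg (gen A t) x.
Proof. by apply: alg_gen_trans => a Aa; apply/alg_base/gen_base. Qed.

(** * Algebraic independence and the exchange property *)

Fixpoint indep (R : comNzRingType) (A : subringClosed R) (s : seq R) : Prop :=
  if s is x :: s' then ~ alg (gen A s') x /\ indep A s' else True.

Section Exchange.
Variables (R : idomainType) (A : subringClosed R).
Implicit Types (x y z : R) (s t u v w : seq R).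

Lemma alg_gen_mem s x : x \in s -> alg (gen A s) x.
Proof. by move=> xs; apply/alg_base/gen_mem. Qed.

Lemma alg_genS s t x : {subset s <= t} -> alg (gen A s) x -> alg (gen A t) x.
Proof. by move=> st; apply/alg_sub/genS. Qed.

(** Read an equation P of y over A[x] as a polynomial T in x over A[y]. If T
    vanished, each of its coefficients would be an equation of y over A, hence
    zero, and P would be zero. *)
Lemma exchange (x y : R) :
  alg (adjoin A x) y -> ~ alg A y -> alg (adjoin A y) x.
Proof.
move=> [P [AP P0 Py]] nAy.
have /choice[r rP] : forall i, exists r, r \is a polyOver A /\ P`_i = r.[x].
  by move=> i; have /adjoinP[r Ar ->] := polyOverP AP i; exists r.
pose T := \sum_(i < size P) y ^+ i *: r i.
pose C j := \poly_(i < size P) (r i)`_j.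
have TC j : T`_j = (C j).[y].
  rewrite horner_poly coef_sum; apply: eq_bigr => i _.
  by rewrite coefZ mulrC.
have AC j : C j \is a polyOver A.
  by apply/polyOver_poly => i _; apply: (polyOverP (rP i).1).
exists T; split.
- by apply/polyOverP=> j; rewrite TC; apply/adjoinP; exists (C j).
- apply: contra_neq P0 => T0; apply/polyP=> i; rewrite coef0 (rP i).2.
  have [lt|le] := ltnP i (size P); last by rewrite -(rP i).2 nth_default.
  rewrite (_ : r i = 0) ?horner0 //; apply/polyP=> j; rewrite coef0.
  have [C0|C0] := eqVneq (C j) 0.
    by have := congr1 (fun p : {poly R} => p`_i) C0; rewrite coef_poly lt coef0.
  by case: nAy; exists (C j); split=> //; rewrite rootE -TC T0 coef0.
- rewrite rootE horner_sum (eq_bigr (fun i : 'I_(size P) => P`_i * y ^+ i)).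
    by rewrite -horner_coef.
  by move=> i _; rewrite hornerZ (rP i).2 mulrC.
Qed.
End Exchange.

Section Steinitz.
Variables (R : idomainType) (A : subringClosed R).
Implicit Types (x y z : R) (s t u v w : seq R).

(** Removing the elements of u one by one, the element z whose removal makes x
    transcendental can be exchanged for x. *)
Lemma exchange_out x u w :
  alg (gen A (u ++ w)) x -> ~ alg (gen A w) x ->
  exists u1 z u2, u = u1 ++ z :: u2 /\ alg (gen A (x :: u2 ++ w)) z.
Proof.
elim: u => //= z u IH axz nax; case: (pselect (alg (gen A (u ++ w)) x)) => [ax|nx].
  by have [u1 [z' [u2 [-> az]]]] := IH ax nax; exists (z :: u1), z', u2.
by exists [::], z, u; split=> //; apply: exchange.
Qed.

Lemma steinitz_exchange w v : indep A w -> (forall x, x \in w -> alg (gen A v) x) ->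
  exists v', (size w + size v')%N = size v /\
             forall x, x \in v -> alg (gen A (v' ++ w)) x.
Proof.
elim: w => [_ _|x w IH [nax iw] xwv].
  by exists v; rewrite cats0; split=> // x; apply: alg_gen_mem.
have [v' [sv vv']] : exists v', (size w + size v')%N = size v /\
    forall x, x \in v -> alg (gen A (v' ++ w)) x.
  by apply: IH => // y yw; apply: xwv; rewrite inE yw orbT.
have ax : alg (gen A (v' ++ w)) x by apply: gen_trans (vv') (xwv x (mem_head _ _)).
have [u1 [z [u2 [e az]]]] := exchange_out ax nax.
exists (u1 ++ u2); split.
  by move: sv; rewrite e !size_cat /= !addnS => <-; rewrite addSn.
move=> y /vv'; apply: gen_trans => t; rewrite e !mem_cat !inE -!orbA => tu.
have [->|tz] := eqVneq t z.
  apply: alg_genS az => q; rewrite !inE !mem_cat !inE.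
  by do 3?[case/orP]=> ->; rewrite ?orbT.
apply: alg_gen_mem; rewrite !mem_cat !inE; move: tu; rewrite (negPf tz) /=.
by do 3?[case/orP]=> ->; rewrite ?orbT.
Qed.

Lemma steinitz w v : indep A w -> (forall x, x \in w -> alg (gen A v) x) ->
  (size w <= size v)%N.
Proof. by move=> iw /(steinitz_exchange iw)[v' [<- _]]; apply: leq_addr. Qed.

Lemma indep_extend u s : indep A u -> exists t,
  [/\ {subset t <= s}, indep A (t ++ u) &
      forall x, x \in s -> alg (gen A (t ++ u)) x].
Proof.
move=> iu; elim: s => [|x s [t [ts it st]]]; first by exists [::].
case: (pselect (alg (gen A (t ++ u)) x)) => [ax|nx].
  exists t; split=> // [y /ts ys|y]; first by rewrite inE ys orbT.
  by rewrite inE => /predU1P[->|/st].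
exists (x :: t); split=> // [y|y]; rewrite !inE.
  by case/predU1P=> [->|/ts->]; rewrite ?eqxx ?orbT.
case/predU1P=> [->|/st]; first by apply: alg_gen_mem; rewrite mem_head.
by apply: alg_genS => z zs; rewrite /= inE zs orbT.
Qed.

Lemma indep_uniq s : indep A s -> uniq s.
Proof.
elim: s => //= x s IH [nx /IH ->]; rewrite andbT; apply/negP => xs.
exact/nx/alg_gen_mem.
Qed.
End Steinitz.

(** * Independence along ring morphisms *)

Section Homs.
Variables (R R1 : comNzRingType) (A : subringClosed R).

Lemma gen_image (f : {rmorphism R -> R1}) (A1 : subringClosed R1) s :
  (forall a, a \in A -> f a \in A1) ->
  forall x, x \in gen A s -> f x \in gen A1 (map f s).
Proof.
move=> AA1; elim: s => // x s IH _ /adjoinP[p Ap ->]; apply/adjoinP.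
exists (map_poly f p); last by rewrite horner_map.
by apply/polyOverP=> i; rewrite coef_map IH // (polyOverP Ap).
Qed.

Lemma gen_image_surj (f : {rmorphism R -> R1}) (A1 : subringClosed R1) s :
  (forall b, b \in A1 -> exists2 a, a \in A & f a = b) ->
  forall y, y \in gen A1 (map f s) -> exists2 x, x \in gen A s & f x = y.
Proof.
move=> AA1; elim: s => // x s IH _ /adjoinP[p Ap ->].
have /choice[r rP] : forall i, exists a, a \in gen A s /\ f a = p`_i.
  by move=> i; have [a As fa] := IH _ (polyOverP Ap i); exists a.
pose q := \poly_(i < size p) r i.
exists q.[x].
  by apply/adjoinP; exists q => //; apply/polyOver_poly => i _; case: (rP i).
rewrite -horner_map; congr (_.[_]); apply/polyP=> i; rewrite coef_map coef_poly.
by case: ltnP => [_|le]; [case: (rP i)|rewrite raddf0 nth_default].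
Qed.

Lemma map_poly_lift (f : {rmorphism R -> R1}) (G : subringClosed R) (G1 : subringClosed R1) :
  (forall b, b \in G1 -> exists2 a, a \in G & f a = b) ->
  forall p, p \is a polyOver G1 -> exists2 q, q \is a polyOver G & map_poly f q = p.
Proof.
move=> GG1 p Gp.
have /choice[r rP] : forall i, exists a, a \in G /\ f a = p`_i.
  by move=> i; have [a Ga fa] := GG1 _ (polyOverP Gp i); exists a.
exists (\poly_(i < size p) r i); first by apply/polyOver_poly => i _;
  case: (rP i).
apply/polyP=> i; rewrite coef_map coef_poly.
by case: ltnP => [_|le]; [case: (rP i)|rewrite raddf0 nth_default].
Qed.

(** If p.[x] is mapped to 0, then the image of p is an equation of f x, hence
    zero, and so are the coefficients of p by induction. *)
Lemma indep_gen_inj (f : {rmorphism R -> R1}) (A1 : subringClosed R1) s :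
  (forall a, a \in A -> f a \in A1) -> (forall a, a \in A -> f a = 0 -> a = 0) ->
  indep A1 (map f s) -> forall x, x \in gen A s -> f x = 0 -> x = 0.
Proof.
move=> AA1 inj; elim: s => [_|x s IH [nfx /IH{}IH]]; first exact: inj.
move=> _ /adjoinP[p Ap ->]; rewrite -horner_map => fp.
have [fp0|fp0] := eqVneq (map_poly f p) 0; last first.
  case: nfx; exists (map_poly f p); split=> //; last exact/eqP.
  by apply/polyOverP=> i; rewrite coef_map; apply: gen_image => //;
    apply: (polyOverP Ap).
rewrite (_ : p = 0) ?horner0 //; apply/polyP=> i; rewrite coef0.
by apply: IH; [apply: (polyOverP Ap)|rewrite -coef_map fp0 coef0].
Qed.

End Homs.

(** Comparison of two quotients R1 and R2 of A[s], where R2 is the smaller one: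
    a relation in R1 lifts to A[s] and then descends to R2. With f1 the identity,
    this says that independence can be tested after applying a morphism. *)
Lemma indep_of_ker (R R1 R2 : comNzRingType) (A : subringClosed R)
    (f1 : {rmorphism R -> R1}) (f2 : {rmorphism R -> R2})
    (A1 : subringClosed R1) (A2 : subringClosed R2) s :
  (forall b, b \in A1 -> exists2 a, a \in A & f1 a = b) ->
  (forall a, a \in A -> f2 a \in A2) -> (forall a, a \in A -> f2 a = 0 -> a = 0) ->
  (forall a, a \in gen A s -> f1 a = 0 -> f2 a = 0) ->
  indep A2 (map f2 s) -> indep A1 (map f1 s).
Proof.
move=> sA1 A2A inj; elim: s => // x s IH ker i2.
have [nx /IH is1] := i2; split; last first.
  by apply: is1 => a As; apply: ker; apply: adjoin_base.
move=> [p [Ap p0 px]].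
have [q Aq qp] := map_poly_lift (gen_image_surj sA1) Ap.
have gqx : q.[x] \in gen A (x :: s) by apply/adjoinP; exists q.
case/negP: p0; rewrite -qp; apply/eqP.
suff -> : q = 0 by rewrite raddf0.
have f2q : f2 q.[x] = 0.
  by apply: ker => //; rewrite -horner_map qp; apply/eqP.
have [fq0|fq0] := eqVneq (map_poly f2 q) 0; last first.
  case: nx; exists (map_poly f2 q); split=> //;
    last by rewrite rootE horner_map f2q.
  by apply/polyOverP=> i; rewrite coef_map; apply: (gen_image A2A);
    apply: (polyOverP Aq).
apply/polyP=> i; rewrite coef0.
apply: (indep_gen_inj A2A inj (i2.2)); first exact: (polyOverP Aq).
by rewrite -coef_map fq0 coef0.
Qed.

(** The constant term of an equation of x lies in A and is mapped to 0 when x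
    is. *)
Lemma alg_ker_trivial (R : idomainType) (R1 : comNzRingType) (f : {rmorphism R -> R1})
    (A : subringClosed R) x :
  (forall a, a \in A -> f a = 0 -> a = 0) -> alg A x -> f x = 0 -> x = 0.
Proof.
move=> inj [p [Ap p0 px]] fx; have [//|x0] := eqVneq x 0.
have [q [Aq q0 qr]] := alg_nonzero_const Ap p0 px x0.
case/eqP: q0; apply: inj; first exact: (polyOverP Aq).
have := congr1 f (rootP qr); rewrite -horner_map fx raddf0 horner_coef0.
by rewrite coef_map.
Qed.

(** Algebraicity survives a specialisation that does not kill the leading
    coefficient of the equation. *)
Lemma alg_image (R R1 : comNzRingType) (f : {rmorphism R -> R1})
    (A : subringClosed R) (A1 : subringClosed R1) p x :
  (forall a, a \in A -> f a \in A1) -> p \is a polyOver A -> root p x ->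
  f (lead_coef p) != 0 -> alg A1 (f x).
Proof.
move=> AA1 Ap px lp; exists (map_poly f p); split.
- by apply/polyOverP=> i; rewrite coef_map AA1 // (polyOverP Ap).
- apply: contraNneq lp => /(congr1 (fun q : {poly _} => q`_(size p).-1)).
  by rewrite coef_map coef0 lead_coefE => ->.
- by rewrite rootE horner_map (rootP px) raddf0.
Qed.

(** * Splitting off the first variable *)

Section FirstVariable.
Variables (R : comNzRingType) (N : nat).

Definition mcons (j : nat) (m : 'X_{1..N}) : 'X_{1..N.+1} :=
  [multinom if unlift ord0 i is Some i' then m i' else j | i < N.+1].

Lemma mcons0 j m : mcons j m ord0 = j.
Proof. by rewrite mnmE unlift_none. Qed.
Lemma mconsS j m i : mcons j m (lift ord0 i) = m i.
Proof. by rewrite mnmE liftK. Qed.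

Definition mtail (m : 'X_{1..N.+1}) : 'X_{1..N} :=
  [multinom m (lift ord0 i) | i < N].

Lemma mcons_eq j m m' : (m' == mcons j m) = (m' ord0 == j) && (mtail m' == m).
Proof.
apply/eqP/andP=> [->|[/eqP <- /eqP <-]].
  rewrite mcons0; split=> //; apply/eqP/mnmP=> i.
  by rewrite mnmE mconsS.
apply/mnmP=> i; rewrite mnmE; case: unliftP => [i' ->|-> //].
by rewrite mnmE.
Qed.

Definition uni_first_var (i : 'I_N.+1) : {poly {mpoly R[N]}} :=
  if unlift ord0 i is Some i' then ('X_i')%:P else 'X.

(** A polynomial in X_0, ..., X_N as a polynomial in X_0 over R[X_1, ..., X_N].
    The first variable is the one to single out because D_1 is applied first:
    the coefficients for D :: S are those for S at divided powers of D. *)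
Definition uni_first : {mpoly R[N.+1]} -> {poly {mpoly R[N]}} :=
  mmap (polyC \o @mpolyC N R) uni_first_var.
HB.instance Definition _ := GRing.RMorphism.on uni_first.

Lemma uni_firstM : {morph uni_first : P Q / P * Q}.
Proof. exact: rmorphM. Qed.

Lemma coef_uni_first P j m : (uni_first P)`_j@_m = P@_(mcons j m).
Proof.
rewrite {1}[P]mpolyE raddf_sum coef_sum raddf_sum [in RHS](mpolyE P) raddf_sum.
apply: eq_bigr => m' _; rewrite /= /uni_first mmapZ mmapX /mmap1 big_ord_recl.
have -> : uni_first_var ord0 = 'X by rewrite /uni_first_var unlift_none.
have -> : \prod_(i < N) uni_first_var (lift ord0 i) ^+ m' (lift ord0 i) =
    ('X_[mtail m'])%:P.
  rewrite mpolyXE_id rmorph_prod; apply: eq_bigr => i _.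
  by rewrite /uni_first_var liftK mnmE rmorphXn.
rewrite /= coefCM coefMC coefXn mcoeffCM mcoeffZ mcoeffX mcons_eq eq_sym.
case: eqP => _; rewrite ?mul1r ?mcoeffX //.
by rewrite mul0r mcoeff0.
Qed.

Lemma uni_first_inj : injective uni_first.
Proof.
move=> P Q e; apply/mpolyP=> m.
have -> : m = mcons (m ord0) (mtail m) by apply/eqP; rewrite mcons_eq !eqxx.
by rewrite -!coef_uni_first e.
Qed.

Definition zero_first (P : {mpoly R[N.+1]}) : {mpoly R[N]} := (uni_first P).[0].
Lemma zero_first_zmod : zmod_morphism zero_first.
Proof. by move=> P Q; rewrite /zero_first rmorphB hornerE hornerN. Qed.
Lemma zero_first_monoid : monoid_morphism zero_first.
Proof. by split=> [|P Q]; rewrite /zero_first ?rmorph1 ?rmorphM ?hornerE. Qed.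
HB.instance Definition _ := GRing.isZmodMorphism.Build _ _ zero_first zero_first_zmod.
HB.instance Definition _ := GRing.isMonoidMorphism.Build _ _ zero_first zero_first_monoid.

Lemma mcoeff_zero_first P m : (zero_first P)@_m = P@_(mcons 0 m).
Proof. by rewrite /zero_first horner_coef0 coef_uni_first. Qed.

Lemma zero_firstC c : zero_first c%:MP = c%:MP.
Proof. by rewrite /zero_first /uni_first mmapC hornerC. Qed.
End FirstVariable.

(** * The map Psi is a ring morphism *)

Section PsiMorph.
Variables (k : fieldType) (B : domAlgType k).
Hypothesis k0 : [pchar k] =i pred0.

Definition divided_power (D : lnd B) j b : B := (j`!%:R : k)^-1 *: iter j D b.

Lemma divided_power0 D b : divided_power D 0 b = b.
Proof. by rewrite /divided_power fact0 invr1 scale1r. Qed.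

Lemma divided_power1 (D : lnd B) b : divided_power D 1 b = D b.
Proof. by rewrite /divided_power invr1 scale1r. Qed.

Lemma natr_char0 n : (n.+1%:R : k) != 0.
Proof. by rewrite (iffLR (pcharf0P k) k0). Qed.

Lemma divided_powerS (D : lnd B) j b : D (divided_power D j b) = j.+1%:R *: divided_power D j.+1 b.
Proof.
rewrite /divided_power lndZ // scalerA factS natrM invfM mulrA divff ?mul1r //.
exact: natr_char0.
Qed.

(** The Leibniz rule, by induction from (j + 1) D^(j+1)/(j+1)! = D (D^j/j!). *)
Lemma divided_powerM D j a b :
  divided_power D j (a * b) = \sum_(i < j.+1) divided_power D i a * divided_power D (j - i) b.
Proof.
elim: j => [|j IH]; first by rewrite big_ord1 !divided_power0.
apply: (scalerI (natr_char0 j)); rewrite -divided_powerS IH raddf_sum.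
(* Both halves of the Leibniz rule become parts of the sum with general term
   (i + (j + 1 - i)) t_i. *)
pose t i := divided_power D i a * divided_power D (j.+1 - i) b.
have -> : \sum_(i < j.+1) D (divided_power D i a * divided_power D (j - i) b) =
    \sum_(i < j.+2) ((i%:R : k) *: t i + ((j.+1 - i)%:R : k) *: t i).
  rewrite [RHS]big_split [X in _ = X + _]big_ord_recl [X in _ = _ + X]big_ord_recr /=.
  rewrite subnn !scale0r add0r addr0 -big_split /=; apply: eq_bigr => i _.
  rewrite lnd_leibniz !divided_powerS -(scalerAl i.+1%:R) -(scalerAr (j - i).+1%:R).
  by rewrite /t -subSn ?subSS ?leq_ord.
rewrite scaler_sumr; apply: eq_bigr => i _.
by rewrite -scalerDl -natrD subnKC // -ltnS.
Qed.

Lemma Psi_coef_cons N (S : N.-tuple (lnd B)) D j m b :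
  Psi_coef [tuple of D :: S] (mcons j m) b = Psi_coef S m (divided_power D j b).
Proof.
rewrite /Psi_coef big_ord_recl mcons0 enum_ordSl iter_lnds_cons mcons0.
have -> s b' : iter_lnds [tuple of D :: S] (mcons j m) (map (lift ord0) s) b' =
    iter_lnds S m s b'.
  by elim: s b' => // i s IH b';
    rewrite map_cons !iter_lnds_cons IH mconsS tnthS.
under eq_bigr do rewrite mconsS.
rewrite /divided_power iter_lndsZ // scalerA natrM invfM mulrC;
  congr (_ *: iter_lnds _ _ _ _).
Qed.

Lemma coef_uni_first_Psi N (S : N.-tuple (lnd B)) D j b :
  (uni_first (Psi [tuple of D :: S] b))`_j = Psi S (divided_power D j b).
Proof. by apply/mpolyP=> m; rewrite coef_uni_first !mcoeff_Psi Psi_coef_cons. Qed.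

Lemma PsiM N (S : N.-tuple (lnd B)) : {morph Psi S : a b / a * b}.
Proof.
elim: N S => [|N IH] S a b.
  have P0 c : Psi S c = c%:MP.
    apply/mpolyP=> m; rewrite mcoeff_Psi /Psi_coef big_ord0 invr1 scale1r.
    have -> : enum 'I_0 = [::] by apply: size0nil; rewrite size_enum_ord.
    by rewrite mcoeffC (_ : m == 0%MM) ?mulr1 //; apply/eqP/mnmP=> -[].
  by rewrite !P0 mpolyCM.
case/tupleP: S => D S; apply: uni_first_inj; apply/polyP=> j.
have Psi0 : Psi S 0 = 0 by apply: (addrI (Psi S 0)); rewrite -PsiD !addr0.
rewrite [LHS]coef_uni_first_Psi divided_powerM uni_firstM coefM.
rewrite (big_morph (Psi S) (PsiD S) Psi0).
by apply: eq_bigr => i _; rewrite IH -!(coef_uni_first_Psi S D).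
Qed.

Lemma Psi1 N (S : N.-tuple (lnd B)) : Psi S 1 = 1.
Proof.
have e : Psi S 1 * Psi S 1 = Psi S 1 by rewrite -PsiM mulr1.
have n0 : Psi S 1 != 0.
  apply/negP=> /eqP/(congr1 (mcoeff 0%MM)).
  rewrite mcoeff_Psi /Psi_coef mcoeff0.
  have -> s b : iter_lnds S 0%MM s b = b.
    by elim: s b => // i s IH b; rewrite iter_lnds_cons IH mnm0E.
  rewrite big1 ?invr1 ?scale1r => [/eqP|i _]; last by rewrite mnm0E.
  by rewrite oner_eq0.
by apply: (mulfI n0); rewrite e mulr1.
Qed.
End PsiMorph.

(** * Linear independence over the base field *)

Section LinearFree.
Variables (k : fieldType) (V : lmodType k).

Definition linfree m (l : 'I_m -> V) : Prop :=
  forall e : 'I_m -> k, \sum_i e i *: l i = 0 -> forall i, e i = 0.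

Lemma linfree_lift m (l : 'I_m.+1 -> V) i0 :
  linfree l -> linfree (fun i => l (lift i0 i)).
Proof.
move=> fl e el i; pose e' j := if unlift i0 j is Some j' then e j' else 0.
have -> : e i = e' (lift i0 i) by rewrite /e' liftK.
apply: fl; rewrite (bigD1_ord i0) //= /e' unlift_none scale0r add0r -[RHS]el.
by apply: eq_bigr => j _; rewrite liftK.
Qed.

Definition in_lspan m (l : 'I_m -> V) (x : V) : Prop :=
  exists a : 'I_m -> k, x = \sum_i a i *: l i.

Lemma linfree_span (X : seq V) :
  exists m (l : 'I_m -> V), linfree l /\ forall x, x \in X -> in_lspan l x.
Proof.
have : exists m (l : 'I_m -> V), forall x, x \in X -> in_lspan l x.
  exists (size X), (fun i => X`_i) => x xX.
  have lt : (index x X < size X)%N by rewrite index_mem.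
  exists (fun i => (i == Ordinal lt)%:R);
    rewrite (bigD1 (Ordinal lt)) //= eqxx scale1r.
  by rewrite nth_index // big1 ?addr0 // => i /negPf->; rewrite scale0r.
case=> m; elim: m => [|m IH] [l lX].
  by exists 0%N, l; split=> // e _ [].
case: (pselect (linfree l)) => [fl|nfl]; first by exists m.+1, l.
apply: IH; move/existsNP: nfl => [e /not_implyP[el /existsNP[i0 /eqP ei0]]].
exists (fun i => l (lift i0 i)) => x /lX[a ->].
exists (fun i => a (lift i0 i) - a i0 / e i0 * e (lift i0 i)).
have li0 : l i0 = - \sum_i (e i0)^-1 *: (e (lift i0 i) *: l (lift i0 i)).
  move: el; rewrite (bigD1_ord i0) //= => /(canRL (addrK _));
    rewrite sub0r => el.
  by rewrite -scaler_sumr -scalerN -el scalerA mulVf // scale1r.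
rewrite (bigD1_ord i0) //= {1}li0 scalerN scaler_sumr -sumrN -big_split /=.
by apply: eq_bigr => i _; rewrite !scalerA scalerBl addrC.
Qed.
End LinearFree.

Section Sums.
Variables (R L : comNzRingType) (f : {rmorphism R -> L}).
Variables (G : subringClosed R) (C : subringClosed L).

(** The subring C f(G) generated by C and f(G). *)
Definition bilinear_sums : {pred L} := fun y => `[< exists t : seq (L * R),
  (forall z, z \in t -> z.1 \in C /\ z.2 \in G) /\ y = \sum_(z <- t) z.1 * f z.2 >].

Lemma bilinear_sumsP y : reflect (exists t : seq (L * R),
  (forall z, z \in t -> z.1 \in C /\ z.2 \in G) /\ y = \sum_(z <- t) z.1 * f z.2)
  (y \in bilinear_sums).
Proof. exact: asboolP. Qed.

Lemma bilinear_sums_subring : subring_closed bilinear_sums.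
Proof.
split=> [|_ _ /bilinear_sumsP[s [sP ->]] /bilinear_sumsP[t [tP ->]]|
  _ _ /bilinear_sumsP[s [sP ->]] /bilinear_sumsP[t [tP ->]]];
  apply/bilinear_sumsP.
- exists [:: (1, 1)]; split=> [z|]; last by rewrite big_seq1 /= rmorph1 mulr1.
  by rewrite inE => /eqP->; rewrite !rpred1.
- exists (s ++ [seq (- z.1, z.2) | z <- t]); split=> [z|].
    rewrite mem_cat => /orP[/sP//|/mapP[z' /tP[? ?] ->]].
    by rewrite rpredN.
  by rewrite big_cat big_map -sumrN /=; congr (_ + _); apply: eq_bigr => z _;
    rewrite mulNr.
- exists [seq (z.1 * z'.1, z.2 * z'.2) | z <- s, z' <- t]; split=> [z|].
    by move=> /allpairsP[[a b] /= [/sP[? ?] /tP[? ?] ->]]; rewrite !rpredM.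
  rewrite big_allpairs_dep /= mulr_suml; apply: eq_bigr => z _.
  by rewrite mulr_sumr; apply: eq_bigr => z' _; rewrite rmorphM mulrACA.
Qed.
HB.instance Definition _ := GRing.isSubringClosed.Build L bilinear_sums bilinear_sums_subring.

End Sums.

(** Elements of C[f(s)] are C-linear combinations of images of elements of
    A[s]. *)
Lemma gen_bilinear_sums (R L : comNzRingType) (f : {rmorphism R -> L})
  (A : subringClosed R) (C : subringClosed L) s :
  {subset gen C (map f s) <= bilinear_sums f (gen A s) C}.
Proof.
apply: gen_min => [c Cc|_ /mapP[x xs ->]]; apply/bilinear_sumsP.
  exists [:: (c, 1)]; rewrite big_seq1 /= rmorph1 mulr1; split=> // z.
  by rewrite inE => /eqP->; rewrite rpred1.
exists [:: (1, x)]; rewrite big_seq1 /= mul1r; split=> // z.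
by rewrite inE => /eqP->; rewrite rpred1 gen_mem.
Qed.

(** * The residue maps of Psi *)

Definition consts (F : comNzRingType) n : subringClosed {mpoly F[n]} :=
  rimage (@mpolyC n F).

Definition scal (k : fieldType) (B : comAlgType k) : subringClosed B :=
  rimage (in_alg B).

Lemma scal_inj (k : fieldType) (B : comAlgType k) (L : nzRingType)
    (f : {rmorphism B -> L}) a :
  a \in scal B -> f a = 0 -> a = 0.
Proof.
move=> /rimageP[c ->] /=; have [->|c0] := eqVneq c 0; first by rewrite scale0r.
move=> /(congr1 (fun x => f (c^-1)%:A * x)); rewrite -rmorphM mulr0.
rewrite -scalerAl mul1r scalerA mulVf // scale1r rmorph1 => /eqP.
by rewrite oner_eq0.
Qed.

Section PsiMorphs.
Variables (k : fieldType) (B : domAlgType k).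
Hypothesis k0 : [pchar k] =i pred0.
Variables (N : nat) (S : N.-tuple (lnd B)).

Lemma Psi_zmod : zmod_morphism (Psi S).
Proof. by move=> a b; apply: (addIr (Psi S b)); rewrite -PsiD !subrK. Qed.
Lemma Psi_monoid : monoid_morphism (Psi S).
Proof. by split; [apply: Psi1|apply: PsiM]. Qed.
Definition Psi_rm : {rmorphism B -> {mpoly B[N]}} :=
  HB.pack (Psi S) (GRing.isZmodMorphism.Build _ _ (Psi S) Psi_zmod)
    (GRing.isMonoidMorphism.Build _ _ (Psi S) Psi_monoid).

Variable p : Spec B.
Definition Psi_at_rm : {rmorphism B -> {mpoly (resfield p)[N]}} :=
  (map_mpoly (to_res p) : {rmorphism _ -> _}) \o Psi_rm.

Lemma Psi_at_rmE b : Psi_at_rm b = Psi_at S p b.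
Proof. by []. Qed.

Lemma Psi_atM a b : Psi_at S p (a * b) = Psi_at S p a * Psi_at S p b.
Proof. exact: (rmorphM Psi_at_rm). Qed.
Lemma Psi_atB a b : Psi_at S p (a - b) = Psi_at S p a - Psi_at S p b.
Proof. exact: (rmorphB Psi_at_rm). Qed.
Lemma Psi_at0 : Psi_at S p 0 = 0.
Proof. exact: (rmorph0 Psi_at_rm). Qed.
Lemma Psi_atZ (x : resfield p) (t : k) (y : B) :
  x *: Psi_at S p (t *: y) = (t *: x : resfield p) *: Psi_at S p y.
Proof. by have [_ _ ->] := hatPsi_balanced S k0 p. Qed.

Lemma Psi_at_scal a : a \in scal B -> Psi_at_rm a \in consts (resfield p) N.
Proof.
move=> /rimageP[c ->]; apply/rimageP; exists (to_res p c%:A).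
rewrite Psi_at_rmE /= -[c *: 1]/(c%:A) /Psi_at PsiZ // Psi1 //.
by rewrite map_mpolyZ rmorph1 -mul_mpolyC mulr1.
Qed.

(** The constant term of Psi(b) is b. *)
Lemma Psi_at_eq0 b : Psi_at S p b = 0 -> b \in p.
Proof.
move=> /(congr1 (mcoeff 0%MM)); rewrite mcoeff_Psi_at mcoeff0 => /eqP.
rewrite to_res_eq0 /Psi_coef.
have -> s b' : iter_lnds S 0%MM s b' = b'.
  by elim: s b' => // i s IH b'; rewrite iter_lnds_cons IH mnm0E.
by rewrite big1 ?invr1 ?scale1r // => i _; rewrite mnm0E.
Qed.

Lemma zero_first_Psi_at D b : zero_first (Psi_at [tuple of D :: S] p b) = Psi_at S p b.
Proof.
by apply/mpolyP=> m; rewrite mcoeff_zero_first !mcoeff_Psi_at Psi_coef_cons // divided_power0.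
Qed.

(** The coefficient of the first variable in Psi for D :: S is Psi for S, taken at
    D b. *)
Lemma Psi_at_cons_rel D m (c : 'I_m -> resfield p) (b : 'I_m -> B) :
  \sum_i c i *: Psi_at [tuple of D :: S] p (b i) = 0 ->
  \sum_i c i *: Psi_at S p (D (b i)) = 0.
Proof.
move=> e; apply/mpolyP=> mm; rewrite mcoeff0 -[RHS](mcoeff0 _ (mcons 1 mm)) -e.
rewrite !raddf_sum; apply: eq_bigr => i _.
by rewrite /= !mcoeffZ !mcoeff_Psi_at Psi_coef_cons // divided_power1.
Qed.
End PsiMorphs.

(** * Linear disjointness at a prime *)

Section ConstantFixing.
Variables (F : comNzRingType) (N n : nat).
Variable f : {rmorphism {mpoly F[N]} -> {mpoly F[n]}}.
Hypothesis fC : forall c, f c%:MP = c%:MP.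

Lemma consts_image a : a \in consts F N -> f a \in consts F n.
Proof. by move=> /rimageP[c ->]; rewrite /= fC mem_rimage. Qed.

Lemma consts_inj a : a \in consts F N -> f a = 0 -> a = 0.
Proof.
move=> /rimageP[c ->]; rewrite /= fC => /(congr1 (mcoeff 0%MM)).
by rewrite mcoeffC eqxx mulr1 mcoeff0 => ->; rewrite mpolyC0.
Qed.

Lemma indep_of_image I : indep (consts F n) (map f I) -> indep (consts F N) I.
Proof.
move=> i; rewrite -[I]map_id.
apply: (indep_of_ker (A := consts F N) (f1 := idfun) (f2 := f)) i => //.
- by move=> b Cb; exists b.
- exact: consts_image.
- exact: consts_inj.
- by move=> a _ /= ->; rewrite rmorph0.
Qed.

Lemma gen_inj_of_image I x : indep (consts F n) (map f I) ->
  x \in gen (consts F N) I -> f x = 0 -> x = 0.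
Proof.
move=> i; exact: (indep_gen_inj consts_image consts_inj i).
Qed.
End ConstantFixing.

Lemma indep_zero_first (F : idomainType) N (I : seq {mpoly F[N.+1]}) :
  indep (consts F N) (map (@zero_first F N) I) -> indep (consts F N.+1) I.
Proof. exact/indep_of_image/zero_firstC. Qed.

Lemma zero_first_alg_inj (F : idomainType) N (I : seq {mpoly F[N.+1]}) x :
  indep (consts F N) (map (@zero_first F N) I) ->
  alg (gen (consts F N.+1) I) x -> zero_first x = 0 -> x = 0.
Proof.
move=> iI; apply: alg_ker_trivial => a; apply: gen_inj_of_image iI;
  exact: zero_firstC.
Qed.

Lemma alg_lincomb (F : idomainType) N (I : seq {mpoly F[N]}) m (c : 'I_m -> F)
    (x : 'I_m -> {mpoly F[N]}) :
  (forall i, alg (gen (consts F N) I) (x i)) ->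
  alg (gen (consts F N) I) (\sum_i c i *: x i).
Proof.
move=> ax; apply/alg_closureP; apply: rpred_sum => i _;
  rewrite -mul_mpolyC rpredM //.
  by apply/alg_closureP/alg_base/gen_base/mem_rimage.
exact/alg_closureP.
Qed.

Lemma zero_first_lincomb (F : comNzRingType) N m (c : 'I_m -> F) (x : 'I_m -> {mpoly F[N.+1]}) :
  zero_first (\sum_i c i *: x i) = \sum_i c i *: zero_first (x i).
Proof.
rewrite raddf_sum; apply: eq_bigr => i _ /=.
by rewrite -mul_mpolyC rmorphM /= zero_firstC mul_mpolyC.
Qed.

Lemma lincomb_cross (F : comNzRingType) N m (c : 'I_m -> F)
    (u v : 'I_m -> {mpoly F[N]}) (x y : {mpoly F[N]}) :
  \sum_i c i *: u i = 0 -> \sum_i c i *: v i = 0 ->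
  \sum_i c i *: (x * u i - y * v i) = 0.
Proof.
move=> eu ev; transitivity (x * (\sum_i c i *: u i) - y * (\sum_i c i *: v i));
  last first.
  by rewrite eu ev !mulr0 subr0.
rewrite !mulr_sumr -sumrB; apply: eq_bigr => i _.
by rewrite scalerBr !scalerAr.
Qed.

Lemma mpolyZ_eq0 (F : idomainType) N (c : F) (x : {mpoly F[N]}) :
  c *: x = 0 -> c = 0 \/ x = 0.
Proof.
move/eqP; rewrite -mul_mpolyC mulf_eq0 mpolyC_eq0.
by case/orP=> /eqP; [left|right].
Qed.

Section AtPrime.
Variables (k : fieldType) (B : domAlgType k).
Hypothesis k0 : [pchar k] =i pred0.
Variables (p : Spec B).
Local Notation kap := (resfield p).

(** The relation holds for S' = D :: S, because its left-hand side is algebraic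
    over the images of I and is killed by setting the first variable to 0, which is
    injective there. Then take the coefficient of the first variable. *)
Lemma relations_stable N (S : N.-tuple (lnd B)) (D : lnd B) (I : seq B) :
  let S' := [tuple of D :: S] in
  indep (consts kap N) (map (Psi_at S p) I) ->
  (forall b, alg (gen (consts kap N.+1) (map (Psi_at S' p) I)) (Psi_at S' p b)) ->
  forall m (c : 'I_m -> kap) (b : 'I_m -> B),
  \sum_i c i *: Psi_at S p (b i) = 0 -> \sum_i c i *: Psi_at S p (D (b i)) = 0.
Proof.
move=> S' iI aI m c b e; apply: (Psi_at_cons_rel k0).
apply: (@zero_first_alg_inj kap N (map (Psi_at S' p) I)).
- rewrite -map_comp (eq_map (g := Psi_at S p)) // => x /=.
  exact: zero_first_Psi_at.
- by apply: (@alg_lincomb kap N.+1).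
- rewrite (@zero_first_lincomb kap N) -[RHS]e; apply: eq_bigr => i _ /=.
  by rewrite zero_first_Psi_at.
Qed.

Variables (N : nat) (S : N.-tuple (lnd B)) (Delta : lnd B -> Prop).
Hypothesis KD : forall x, KDelta Delta x -> scalars x.
Hypothesis st : forall D, Delta D -> forall m (c : 'I_m -> kap) (b : 'I_m -> B),
  \sum_i c i *: Psi_at S p (b i) = 0 -> \sum_i c i *: Psi_at S p (D (b i)) = 0.
Hypothesis inj : forall b, Psi_at S p b = 0 -> b = 0.

Lemma iter_cross (D : lnd B) (a b : B) n : b != 0 -> b * D a = a * D b ->
  b * iter n D a = a * iter n D b.
Proof.
move=> b0 e; elim: n => [|n IH] /=; first exact: mulrC.
have := congr1 (fun x => b * D x) IH.
rewrite !lnd_leibniz !mulrDr => /eqP; rewrite -subr_eq0 => /eqP h.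
apply: (mulfI b0); apply/eqP; rewrite -subr_eq0; apply/eqP; rewrite -h.
have -> : b * (D b * iter n D a) = b * (D a * iter n D b).
  by rewrite mulrCA IH mulrCA mulrA -e -mulrA.
by rewrite opprD addrACA subrr add0r.
Qed.

(** The hypothesis says that D (a / b) = 0. If m is the last exponent with
    D^m b <> 0, then D^m a = (a / b) D^m b, so a / b is the quotient of two elements
    of the kernel. *)
Lemma frac_ker_cross (D : lnd B) (a b : B) : b != 0 -> b * D a = a * D b ->
  frac_ker D (a%:F / b%:F).
Proof.
move=> b0 e; have [m [bm bm1]] := lnd_order D b0.
exists (iter m D a), (iter m D b); split=> //.
  have := iter_cross m.+1 b0 e; rewrite bm1 mulr0 => /eqP.
  by rewrite mulf_eq0 (negPf b0) /= => /eqP.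
apply/eqP; rewrite eqr_div -?tofrac0 ?tofrac_eq //.
by rewrite -!tofracM tofrac_eq -(iter_cross m b0 e) mulrC.
Qed.

(** Induction on the number of terms. When some term x is nonzero, the relation
    between the elements x D b_i - b_i D x has one term less; it is trivial by
    induction, and thus every b_i / x is killed by Delta, that is a scalar. *)
Lemma lin_disjoint m (c : 'I_m -> kap) (b : 'I_m -> B) :
  linfree (k := k) c -> \sum_i c i *: Psi_at S p (b i) = 0 -> forall i, b i = 0.
Proof.
elim: m c b => [|m IH] c b fc e i0; first by case: i0.
apply: contrapT => /eqP bi0.
have cross D : Delta D -> forall i, b i0 * D (b i) = b i * D (b i0).
  move=> DD; pose b' i := b i0 * D (b i) - D (b i0) * b i.
  have eb' : \sum_i c i *: Psi_at S p (b' i) = 0.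
    have e1 := st DD e.
    under eq_bigr do rewrite (Psi_atB k0) !(Psi_atM k0).
    exact: (@lincomb_cross kap N m.+1 c (fun i => Psi_at S p (D (b i)))
      (fun i => Psi_at S p (b i)) _ _ e1 e).
  move: eb'; rewrite (bigD1_ord i0) //= {1}/b' mulrC subrr (Psi_at0 k0).
  rewrite scaler0 add0r.
  move=> /(IH _ _ (linfree_lift fc)) b'0 i.
  case: (unliftP i0 i) => [j ->|->]; last by [].
  by apply/eqP; rewrite -subr_eq0 [X in _ - X]mulrC; apply/eqP; apply: b'0.
have /choice[a ea] i : exists a : k, b i = a *: b i0.
  have [a ea] : scalars ((b i)%:F / (b i0)%:F).
    by apply: KD => D DD; apply: frac_ker_cross => //; rewrite cross.
  exists a; apply/eqP; rewrite -tofrac_eq -mulr_algl tofracM -ea divfK //.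
  by rewrite -tofrac0 tofrac_eq.
have : (\sum_i a i *: c i) *: Psi_at S p (b i0) = 0.
  rewrite scaler_suml -[RHS]e; apply: eq_bigr => i _.
  by rewrite [in RHS]ea (Psi_atZ k0).
case/(@mpolyZ_eq0 kap N) => [/fc a0|/inj]; last exact/eqP.
by case/eqP: bi0; rewrite ea a0 scale0r.
Qed.
End AtPrime.

(** * Injectivity on the tensor product *)

Section PureTensors.
Variables (k : fieldType) (A B : comAlgType k).
Lemma ptensDr (a : A) (b b' : B) : ptens a (b + b') = ptens a b + ptens a b'.
Proof. by rewrite -to_tensD; apply/to_tensP/tens_addr. Qed.
Lemma ptensDl (a a' : A) (b : B) : ptens (a + a') b = ptens a b + ptens a' b.
Proof. by rewrite -to_tensD; apply/to_tensP/tens_addl. Qed.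
Lemma ptensZ c (a : A) (b : B) : ptens (c *: a) b = ptens a (c *: b).
Proof. exact/to_tensP/tens_scale. Qed.
Lemma ptens0r (a : A) : ptens a (0 : B) = 0.
Proof. by apply: (addrI (ptens a (0 : B))); rewrite -ptensDr !addr0. Qed.
Lemma ptens0l (b : B) : ptens (0 : A) b = 0.
Proof. by apply: (addrI (ptens (0 : A) b)); rewrite -ptensDl !addr0. Qed.
Lemma ptens_sumr I (r : seq I) (a : A) (F : I -> B) :
  ptens a (\sum_(i <- r) F i) = \sum_(i <- r) ptens a (F i).
Proof. by elim/big_rec2: _ => [|i y1 y2 _ <-]; rewrite ?ptens0r ?ptensDr. Qed.
Lemma ptens_suml I (r : seq I) (b : B) (F : I -> A) :
  ptens (\sum_(i <- r) F i) b = \sum_(i <- r) ptens (F i) b.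
Proof. by elim/big_rec2: _ => [|i y1 y2 _ <-]; rewrite ?ptens0l ?ptensDl. Qed.

(** It suffices to expand the left factors over a linearly independent family. *)
Lemma tens_linfree (x : tens A B) :
  exists m (l : 'I_m -> A) (b : 'I_m -> B),
    linfree (k := k) l /\ x = \sum_i ptens (l i) (b i).
Proof.
elim/tens_ind: x => s; rewrite to_tens_sum.
have [m [l [fl ls]]] := linfree_span (map fst s).
have /choice[e eP] : forall z, exists e : 'I_m -> k,
    z \in s -> z.1 = \sum_i e i *: l i.
  move=> z; case: (boolP (z \in s)) => [zs|_]; last by exists (fun=> 0).
  by have [e ->] := ls _ (map_f fst zs); exists e.
exists m, l, (fun i => \sum_(z <- s) e z i *: z.2); split=> //.
under [RHS]eq_bigr do rewrite ptens_sumr.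
rewrite exchange_big /= !big_seq; apply: eq_bigr => z zs.
by rewrite (eP z zs) ptens_suml; apply: eq_bigr => i _; rewrite ptensZ.
Qed.
End PureTensors.

Section DisjointIndep.
Variables (k : fieldType) (B F : domAlgType k) (N : nat).
Variable f : {rmorphism B -> {mpoly F[N]}}.
Hypothesis fZ : forall (x : F) (t : k) (y : B), x *: f (t *: y) = (t *: x) *: f y.
Hypothesis disj : forall m (c : 'I_m -> F) (b : 'I_m -> B),
  linfree (k := k) c -> \sum_i c i *: f (b i) = 0 -> forall i, b i = 0.

(** Linear disjointness carries independence over k to independence over F: an
    equation of f x over F[f(s)] decomposes, along a family of scalars that is
    independent over k, into equations of x over k[s]. *)
Lemma disjoint_indep s : indep (scal B) s -> indep (consts F N) (map f s).
Proof.
elim: s => // x s IH [nx /IH is1]; split=> //= -[Q [GQ Q0 Qx]].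
have /choice[t tP] : forall j, exists t : seq ({mpoly F[N]} * B),
   (forall z, z \in t -> z.1 \in consts F N /\ z.2 \in gen (scal B) s) /\
   Q`_j = \sum_(z <- t) z.1 * f z.2.
  by move=> j; apply/(bilinear_sumsP f); apply: gen_bilinear_sums;
    apply: (polyOverP GQ).
(* All scalars that occur in the coefficients of Q are expanded over one family l. *)
pose X : seq F := flatten [seq [seq z.1@_0 | z <- t j] | j <- iota 0 (size Q)].
have [m [l [fl lX]]] := linfree_span X.
have /choice[a aP] : forall j, exists a : 'I_m -> B,
    (forall i, a i \in gen (scal B) s) /\
    ((j < size Q)%N -> Q`_j = \sum_i l i *: f (a i)).
  move=> j; case: (ltnP j (size Q)) => [lt|_]; last first.
    by exists (fun=> 0); split=> [i|//]; apply: rpred0.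
  have /choice[e eP] : forall z, exists e : 'I_m -> k,
      z \in t j -> z.1@_0 = \sum_i e i *: l i.
    move=> z; case: (boolP (z \in t j)) => [zs|_]; last by exists (fun=> 0).
    have [|e ->] := lX z.1@_0; last by exists e.
    apply/flattenP; exists [seq z.1@_0 | z <- t j]; last by apply/mapP;
      exists z.
    by apply/mapP; exists j; rewrite ?mem_iota.
  have [tC tQ] := tP j.
  exists (fun i => \sum_(z <- t j) e z i *: z.2); split=> [i|_].
    rewrite big_seq; apply: rpred_sum => z /tC[_ zG].
    rewrite -mulr_algl rpredM // gen_base //; exact: (mem_rimage (in_alg B)).
  rewrite tQ; under [RHS]eq_bigr do rewrite raddf_sum scaler_sumr.
  rewrite exchange_big /= !big_seq; apply: eq_bigr => z zt.
  have [/rimageP[c ec] _] := tC z zt; have := eP z zt.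
  rewrite ec /= mcoeffC eqxx mulr1 => ->; rewrite mul_mpolyC scaler_suml.
  by apply: eq_bigr => i _; rewrite fZ.
apply/negP: Q0; apply/negPn/eqP.
have a0 : forall i, \sum_(j < size Q) a j i * x ^+ j = 0.
  apply: (disj fl); rewrite -[RHS](rootP Qx) horner_coef.
  under [RHS]eq_bigr => j _ do rewrite (aP j).2 // mulr_suml.
  rewrite exchange_big /=; apply: eq_bigr => i _.
  rewrite raddf_sum scaler_sumr; apply: eq_bigr => j _.
  by rewrite /= rmorphM rmorphXn scalerAl.
apply/polyP=> j; rewrite coef0; have [lt|] := ltnP j (size Q);
  last exact: nth_default.
rewrite (aP j).2 //; apply: big1 => i _; rewrite (_ : a j i = 0).
  by rewrite raddf0 scaler0.
pose P := \poly_(j < size Q) a j i.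
have [P0|P0] := eqVneq P 0.
  by have := congr1 (fun q : {poly B} => q`_j) P0; rewrite coef_poly lt coef0.
case: nx; exists P; split=> //.
  by apply/polyOver_poly => j' _; case: (aP j').
by rewrite rootE horner_poly a0.
Qed.
End DisjointIndep.

Section AtPrime.
Variables (k : fieldType) (B : domAlgType k).
Hypothesis k0 : [pchar k] =i pred0.
Variables (p : Spec B) (N : nat) (S : N.-tuple (lnd B)).
Local Notation kap := (resfield p).

Hypothesis disj : forall m (c : 'I_m -> kap) (b : 'I_m -> B),
  linfree (k := k) c -> \sum_i c i *: Psi_at S p (b i) = 0 -> forall i, b i = 0.

Lemma hatPsi_inj : injective (hatPsi S (p := p)).
Proof.
move=> x y e; apply/eqP; rewrite -subr_eq0; apply/eqP.
have {e} : hatPsi S (x - y) = 0.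
  have f0 : zmod_morphism (@hatPsi k B N S p) by exact: hatPsi_zmod.
  by rewrite f0 e subrr.
have [m [l [b [fl ->]]]] := tens_linfree (x - y).
have hD := hatPsi_zmod S k0 (p := p).
pose h : {additive ktens p -> {mpoly kap[N]}} :=
  HB.pack (@hatPsi k B N S p) (GRing.isZmodMorphism.Build _ _ (@hatPsi k B N S p) hD).
rewrite -[hatPsi S _]/(h _) raddf_sum /=.
under eq_bigr do rewrite hatPsi_ptens //.
by move=> /(disj fl) b0; apply: big1 => i _; rewrite b0 ptens0r.
Qed.

Lemma indep_Psi_at s : indep (scal B) s -> indep (consts kap N) (map (Psi_at S p) s).
Proof.
apply: (@disjoint_indep k B kap N (Psi_at_rm k0 S p)) => [x t y|m c b].
  exact: Psi_atZ.
exact: disj.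
Qed.
End AtPrime.

(** * The generic point *)

Section ZeroIdeal.
Variable B : idomainType.
Definition zero_pred : {pred B} := fun x => x == 0.
Lemma zero_pred_closed : idealr_closed zero_pred.
Proof.
split; rewrite ?unfold_in /zero_pred ?eqxx ?oner_eq0 // => a u v.
by rewrite !unfold_in => /eqP-> /eqP->; rewrite mulr0 addr0.
Qed.
HB.instance Definition _ := isIdealr.Build B zero_pred zero_pred_closed.
Lemma zero_pred_prime : prime_idealr_closed zero_pred.
Proof. by move=> u v; rewrite !unfold_in /zero_pred mulf_eq0. Qed.
HB.instance Definition _ := isPrimeIdealrClosed.Build B zero_pred zero_pred_prime.
Definition zero_prime : Spec B := zero_pred.
Lemma in_zero_prime x : (x \in zero_prime) = (x == 0). Proof. by []. Qed.
End ZeroIdeal.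

Lemma indep_consts_uniq (F : idomainType) N (s : seq {mpoly F[N]}) :
  indep (consts F N) s -> uniq s.
Proof. exact: indep_uniq. Qed.

Lemma gen_consts_trans (F : idomainType) N (s t : seq {mpoly F[N]}) x :
  (forall y, y \in s -> alg (gen (consts F N) t) y) ->
  alg (gen (consts F N) s) x -> alg (gen (consts F N) t) x.
Proof. exact: gen_trans. Qed.

Section Basis.
Variables (k : fieldType) (B : domAlgType k).
Hypothesis k0 : [pchar k] =i pred0.
Variable bs : seq B.
Hypothesis bs_indep : indep (scal B) bs.
Hypothesis bs_alg : forall b, alg (gen (scal B) bs) b.

Lemma Psi_at_alg p N (S : N.-tuple (lnd B)) :
  (forall b, b \in gen (scal B) bs -> Psi_at S p b = 0 -> b = 0) ->
  forall b, alg (gen (consts (resfield p) N) (map (Psi_at S p) bs)) (Psi_at S p b).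
Proof.
move=> inj b; have [P [GP P0 Pb]] := bs_alg b.
apply: (alg_image (f := Psi_at_rm k0 S p) _ GP Pb).
  apply: (gen_image (f := Psi_at_rm k0 S p)); exact: Psi_at_scal.
apply: contra_neq P0 => /inj e; apply/eqP; rewrite -lead_coef_eq0 e //.
exact: (polyOverP GP).
Qed.

Lemma Psi_at_alg_inj p N (S : N.-tuple (lnd B)) :
  indep (consts (resfield p) N) (map (Psi_at S p) bs) ->
  forall b, Psi_at S p b = 0 -> b = 0.
Proof.
move=> i b; apply: (alg_ker_trivial (f := Psi_at_rm k0 S p)) (bs_alg b).
apply: (indep_gen_inj (f := Psi_at_rm k0 S p)) i; first exact: Psi_at_scal.
exact: scal_inj.
Qed.

Variable Delta : lnd B -> Prop.
Hypothesis KD : forall x, KDelta Delta x -> scalars x.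

Lemma hatPsi_inj_of_indep p N (S : N.-tuple (lnd B)) :
  indep (consts (resfield p) N) (map (Psi_at S p) bs) ->
  injective (hatPsi S (p := p)).
Proof.
move=> i; have inj := Psi_at_alg_inj i.
apply: hatPsi_inj => // m c b; apply: (lin_disjoint k0 KD _ inj).
move=> D DD; apply: (relations_stable k0 i); apply: Psi_at_alg => b' _ e'.
by apply: inj; rewrite -(zero_first_Psi_at k0 S p D) e' (rmorph0 (@zero_first (resfield p) N)).
Qed.

Definition separates (p : Spec B) (I : seq B) : Prop :=
  exists N (S : N.-tuple (lnd B)), [/\ forall j, Delta (tnth S j),
    (exists D, Delta D) -> (0 < N)%N &
    indep (consts (resfield p) N) (map (Psi_at S p) I)].

(** Take a sequence S and a part I of the basis, as large as possible, whose images
    are independent. For D in Delta the images under D :: S of the other basis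
    elements are algebraic over those of I, by maximality, which is what
    relations_stable requires. *)
Lemma generic_indep : separates (zero_prime B) bs.
Proof.
set p := zero_prime B.
have inj0 N (S : N.-tuple (lnd B)) b : Psi_at S p b = 0 -> b = 0.
  by move/Psi_at_eq0; rewrite in_zero_prime => /eqP.
pose Q j := `[< exists I, [/\ {subset I <= bs}, size I = j & separates p I] >].
have Q0 : exists j, Q j.
  exists 0%N; apply/asboolP; exists [::]; split=> //.
  case: (pselect (exists D, Delta D)) => [[D DD]|nD].
    by exists 1%N, [tuple D]; split=> // j; rewrite (tnth_nth D) (ord1 j).
  by exists 0%N, [tuple]; split=> // -[].
have Qb j : Q j -> (j <= size bs)%N.
  move=> /asboolP[I [Ib <- [N [S [_ _ iI]]]]].
  have /map_uniq uI := @indep_consts_uniq (resfield p) N _ iI.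
  exact: uniq_leq_size.
have [j /asboolP[I [Ib sI [N [S [DS N0 iI]]]]] jmax] := ex_maxnP Q0 Qb.
exists N, S; split=> //; apply: (@indep_Psi_at k B k0 p N S) => // m c b.
apply: (lin_disjoint k0 KD _ (@inj0 N S)) => D DD.
apply: (relations_stable k0 iI) => b'.
set S' := [tuple of D :: S].
have iI' : indep (consts (resfield p) N.+1) (map (Psi_at S' p) I).
  apply: (@indep_zero_first (resfield p) N); rewrite -map_comp.
  rewrite (eq_map (g := Psi_at S p)) // => x /=; exact: zero_first_Psi_at.
apply: (@gen_consts_trans (resfield p) N.+1) (Psi_at_alg _ b') =>
  [_ /mapP[x xb ->]|b'' _]; last exact: inj0.
apply: contrapT => nx.
suff /jmax : Q j.+1 by rewrite ltnn.
apply/asboolP; exists (x :: I); split=> [y||]; last 1 first.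
- exists N.+1, S'; split=> // i.
  case: (unliftP ord0 i) => [i' ->|->]; by rewrite ?tnth0 ?tnthS.
- by rewrite inE => /predU1P[->|/Ib].
- by rewrite /= sI.
Qed.
End Basis.

(** * From the generic point to an open set *)

Section IndependentVariables.
Variables (F : idomainType) (n : nat).

Lemma mpoly_in_gen (P : {mpoly F[n]}) :
  P \in gen (consts F n) [seq 'X_i | i <- enum 'I_n].
Proof.
rewrite [P]mpolyE rpred_sum // => m _; rewrite -mul_mpolyC rpredM //.
  exact/gen_base/mem_rimage.
rewrite mpolyXE_id rpred_prod // => i _; rewrite rpredX //.
by apply/gen_mem/map_f; rewrite mem_enum.
Qed.

Definition pick_var (i j : 'I_n) : {poly {mpoly F[n]}} :=
  if j == i then 'X else ('X_j)%:P.

(** Substituting a new variable for X_i fixes the polynomials in the other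
    variables, so it maps p.[X_i] to p. *)
Lemma indep_vars (s : seq 'I_n) : uniq s -> indep (consts F n) [seq 'X_i | i <- s].
Proof.
elim: s => //= i s IH /andP[is_ us]; split; last exact: IH.
move=> [p [Gp /eqP p0 pX]]; case: p0.
pose ev : {rmorphism {mpoly F[n]} -> {poly {mpoly F[n]}}} :=
  mmap (polyC \o @mpolyC n F) (pick_var i).
have evG a : a \in gen (consts F n) [seq 'X_j | j <- s] -> ev a = a%:P.
  elim: (s) is_ a => [_ a /rimageP[c ->]|j s' IH' ] /=; first by rewrite mmapC.
  rewrite inE negb_or => /andP[ij is'] a /adjoinP[q Gq ->].
  rewrite -horner_map.
  have -> : map_poly ev q = map_poly polyC q.
    by apply/polyP=> t; rewrite !coef_map /= IH' ?(polyOverP Gq).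
  by rewrite /= mmapX mmap1U /pick_var eq_sym (negPf ij) horner_map.
have := congr1 ev (rootP pX); rewrite -horner_map rmorph0.
have -> : map_poly ev p = map_poly polyC p.
  by apply/polyP=> t; rewrite !coef_map /= evG ?(polyOverP Gp).
by rewrite /= mmapX mmap1U /pick_var eqxx -[_.['X]]/(p \Po 'X) comp_polyXr.
Qed.
End IndependentVariables.

Lemma dependent_smaller_span (R : idomainType) (A : subringClosed R) (v : seq R) :
  ~ indep A v -> exists v', (size v' < size v)%N /\
     forall x, x \in v -> alg (gen A v') x.
Proof.
elim: v => [[]//|x s IH nxs]; case: (pselect (alg (gen A s) x)) => [ax|nx].
  exists s; split=> // y; rewrite inE => /predU1P[->//|]; exact: alg_gen_mem.
have [s' [ss' as']] : exists s', (size s' < size s)%N /\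
     forall x, x \in s -> alg (gen A s') x by apply: IH => is_; apply: nxs.
exists (x :: s'); split=> // y; rewrite inE => /predU1P[->|/as'].
  exact/alg_gen_mem/mem_head.
by apply: alg_genS => z zs; rewrite inE zs orbT.
Qed.

(** If v were dependent, a family shorter than w would span w, against Steinitz
    exchange. *)
Lemma indep_of_span (R : idomainType) (A : subringClosed R) (v w : seq R) :
  indep A w -> (forall x, x \in w -> alg (gen A v) x) -> (size v <= size w)%N ->
  indep A v.
Proof.
move=> iw wv vw; apply: contrapT => /dependent_smaller_span[v' [lt vv']].
suff : (size w <= size v')%N by rewrite leqNgt (leq_trans lt vw).
by apply: (steinitz iw) => x /wv; apply: gen_trans.
Qed.

Lemma poly_nonroot (F : idomainType) (p : {poly F}) :
  (forall n, (n.+1%:R : F) != 0) -> p != 0 -> exists n, ~~ root p n%:R.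
Proof.
move=> F0 p0; apply: contrapT => nex.
have rp n : root p n%:R by apply: contrapT => /negP rn; apply: nex; exists n.
pose rs : seq F := [seq n%:R | n <- iota 0 (size p)].
have inj : injective (fun n => n%:R : F).
  have h m d : (m%:R : F) = (m + d.+1)%:R -> False.
    by rewrite natrD -{1}[m%:R]addr0 => /addrI/esym/eqP; rewrite (negPf (F0 d)).
  move=> m n e; case: (ltngtP m n) => // lt.
    by case: (h m (n - m.+1)%N); rewrite e addnS -addSn subnKC.
  by case: (h n (m - n.+1)%N); rewrite -e addnS -addSn subnKC.
have : (size rs < size p)%N.
  apply: max_poly_roots => //; first by apply/allP=> _ /mapP[m _ ->].
  by rewrite map_inj_uniq ?iota_uniq.
by rewrite size_map size_iota ltnn.
Qed.

Lemma meval_uni_first (F : comNzRingType) n (v : 'I_n.+1 -> F) (P : {mpoly F[n.+1]}) :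
  P.@[v] = (map_poly (meval (fun i => v (lift ord0 i))) (uni_first P)).[v ord0].
Proof.
have -> : uni_first P = \sum_(m <- msupp P) uni_first (P@_m *: 'X_[m]).
  by rewrite {1}[P]mpolyE raddf_sum.
rewrite {1}[P]mpolyE !rmorph_sum horner_sum.
apply: eq_bigr => m _; rewrite /= -mul_mpolyC uni_firstM !rmorphM hornerM /= mevalC.
rewrite /uni_first mmapC mmapX /= map_polyC hornerC /= mevalC; congr (_ * _).
rewrite mevalX /mmap1 rmorph_prod horner_prod; apply: eq_bigr => i _.
rewrite rmorphXn horner_exp /uni_first_var; case: unliftP => [i' ->|->].
  by rewrite /= map_polyC hornerC /= mevalXU.
by rewrite /= map_polyX hornerX.
Qed.

Lemma mpoly_nonroot (F : idomainType) n (P : {mpoly F[n]}) :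
  (forall n, (n.+1%:R : F) != 0) -> P != 0 ->
  exists c : 'I_n -> nat, P.@[fun i => (c i)%:R] != 0.
Proof.
move=> F0; elim: n P => [|n IH] P P0.
  have eP : P = (P@_0)%:MP.
    apply/mpolyP=> m; have -> : m = 0%MM by apply/mnmP=> -[].
    by rewrite mcoeffC eqxx mulr1.
  by exists (fun=> 0%N); rewrite eP mevalC; apply: contra_neq P0 => e;
    rewrite eP e.
have [j Pj] : exists j, (uni_first P)`_j != 0.
  apply: contrapT => nex; case/eqP: P0; apply: uni_first_inj; rewrite rmorph0.
  apply/polyP=> j; rewrite coef0; apply/eqP/negPn/negP=> h; apply: nex;
    by exists j.
have [c' c'P] := IH _ Pj.
have q0 : map_poly (meval (fun i => (c' i)%:R)) (uni_first P) != 0.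
  by apply: contra_neq c'P => /(congr1 (fun q : {poly F} => q`_j));
    rewrite coef_map coef0.
have [m rm] := poly_nonroot F0 q0.
exists (fun i => if unlift ord0 i is Some i' then c' i' else m).
rewrite meval_uni_first unlift_none.
rewrite (eq_map_poly (g := meval (fun i => (c' i)%:R))) // => Q.
by apply: meval_eq => i; rewrite liftK.
Qed.

(** Substitution of natural numbers for some variables, while the others are
    renamed; it makes sense over all rings of coefficients at once. *)
Section Subst.
Variables (F : comNzRingType) (N n : nat) (sg : 'I_N -> nat + 'I_n).
Definition subst_var (i : 'I_N) : {mpoly F[n]} :=
  match sg i with inl m => m%:R | inr j => 'X_j end.
Definition subst : {mpoly F[N]} -> {mpoly F[n]} := mmap (@mpolyC n F) subst_var.
HB.instance Definition _ := GRing.RMorphism.on subst.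
Lemma substC c : subst c%:MP = c%:MP.
Proof. by rewrite /subst mmapC. Qed.
Lemma substX i : subst 'X_i = subst_var i.
Proof. by rewrite /subst mmapX mmap1U. Qed.
Lemma substZ c P : subst (c *: P) = c *: subst P.
Proof. by rewrite /subst mmapZ mul_mpolyC. Qed.
End Subst.

Lemma mpoly_rmorph_eq (R S : comNzRingType) n (f g : {rmorphism {mpoly R[n]} -> S}) :
  (forall c, f c%:MP = g c%:MP) -> (forall i, f 'X_i = g 'X_i) -> f =1 g.
Proof.
move=> eC eX P; rewrite [P]mpolyE !rmorph_sum; apply: eq_bigr => m _.
rewrite -mul_mpolyC !rmorphM eC; congr (_ * _).
rewrite mpolyXE_id !rmorph_prod; apply: eq_bigr => i _.
by rewrite !rmorphXn eX.
Qed.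

Section Spread.
Variables (B : idomainType) (N : nat) (u : seq {mpoly B[N]}).
Hypothesis B0 : forall n, (n.+1%:R : B) != 0.
Hypothesis iu : indep (consts B N) u.

Definition reduce (F : comNzRingType) (g : {rmorphism B -> F}) n
    (sg : 'I_N -> nat + 'I_n) : {rmorphism {mpoly B[N]} -> {mpoly F[n]}} :=
  (subst sg : {rmorphism _ -> _}) \o (map_mpoly g : {rmorphism _ -> _}).

(** The variables in t complete u to a transcendence basis over B and become the
    numbers c; the variables in J remain. The point c is chosen where the product H
    of the leading coefficients of the equations q_i of the X_i does not vanish,
    and f is the value of H there. *)
Lemma independence_spreads : exists (f : B) (sg : 'I_N -> nat + 'I_(size u)), f != 0 /\
  forall (F : idomainType) (g : {rmorphism B -> F}), g f != 0 ->
    indep (consts F (size u)) (map (reduce g sg) u).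
Proof.
pose Xs : seq {mpoly B[N]} := [seq 'X_i | i <- enum 'I_N].
have [t [tX itu Xt]] := indep_extend Xs iu.
have iX : indep (consts B N) Xs by apply: indep_vars; apply: enum_uniq.
have stu : (size t + size u = N)%N.
  have sX : size Xs = N by rewrite size_map size_enum_ord.
  apply/eqP; rewrite -size_cat eqn_leq.
  have := steinitz iX Xt; rewrite sX => ->; rewrite andbT.
  have /(steinitz itu) : forall x, x \in t ++ u -> alg (gen (consts B N) Xs) x.
    by move=> x _; apply/alg_base/mpoly_in_gen.
  by rewrite sX.
(* An equation of each variable over the basis t ++ u. *)
have /choice[q qP] : forall i : 'I_N, exists q,
    [/\ q \is a polyOver (gen (consts B N) (t ++ u)), q != 0 & root q 'X_i].
  by move=> i; apply: Xt; apply: map_f; rewrite mem_enum.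
pose H := \prod_i lead_coef (q i).
have H0 : H != 0.
  by apply/prodf_neq0 => i _; rewrite lead_coef_eq0; case: (qP i).
have [c Hc] := mpoly_nonroot B0 H0.
pose J := [seq i <- enum 'I_N | 'X_i \notin t].
have sJ : size J = size u.
  apply/eqP; rewrite -(eqn_add2l (size t)) stu; apply/eqP.
  have -> : size t = size [seq i <- enum 'I_N | 'X_i \in t].
    rewrite -(size_map (fun i => 'X_i : {mpoly B[N]})); apply: perm_size.
    apply: uniq_perm.
    + by have := indep_uniq itu; rewrite cat_uniq => /andP[].
    + rewrite map_inj_uniq; first exact/filter_uniq/enum_uniq.
      move=> i j e.
      have := congr1 (mcoeff U_(i)) e; rewrite !mcoeffX eqxx.
      case: eqP => [/(congr1 (fun m : 'X_{1..N} => m i))|_ /eqP];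
        last by rewrite oner_eq0.
      by rewrite !mnm1E eqxx; case: eqP => [->|].
    + move=> x; apply/idP/mapP => [xt|[i + ->]];
      last by rewrite mem_filter => /andP[].
      have /mapP[i iN ex] := tX _ xt; exists i => //.
      by rewrite mem_filter -ex xt.
  by rewrite !size_filter count_predC size_enum_ord.
pose sg (i : 'I_N) : nat + 'I_(size u) :=
  if insub (index i J) is Some j then inr j else inl (c i).
exists (H.@[fun i => (c i)%:R]), sg; split=> // F g gf.
pose phi := reduce g sg.
have phiC b : phi b%:MP = (g b)%:MP by rewrite /= map_mpolyC substC.
have phiX i : phi 'X_i = subst_var F sg i by rewrite /= map_mpolyX substX.
have phi_consts a : a \in consts B N -> phi a \in consts F (size u).
  by move=> /rimageP[b ->]; rewrite phiC mem_rimage.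
(* Giving the value c_i to the remaining variables maps phi H to g f. *)
have phiH : phi H != 0.
  pose e (j : 'I_(size u)) : F :=
    if insub (nth N (map val J) j) is Some i then (c i)%:R else 0.
  apply: contra_neq gf => phiH0.
  pose f1 : {rmorphism {mpoly B[N]} -> F} := (meval e : {rmorphism _ -> _}) \o phi.
  pose f2 : {rmorphism {mpoly B[N]} -> F} :=
    g \o (meval (fun i => (c i)%:R) : {rmorphism _ -> _}).
  rewrite -[LHS]/(f2 H) -(mpoly_rmorph_eq (f := f1)).
  - by rewrite /= -[subst _ _]/(phi H) phiH0 meval0.
  - by move=> b; rewrite /f1 /f2 /= -[subst _ _]/(phi b%:MP) phiC !mevalC.
  - move=> i; rewrite /f1 /f2 /= -[subst _ _]/(phi 'X_i) phiX mevalXU rmorph_nat.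
    rewrite /subst_var /sg; case: insubP => [j _ ej|_];
      last by rewrite rmorph_nat.
    have iJ : i \in J by rewrite -index_mem -ej sJ ltn_ord.
    rewrite mevalXU /e ej (nth_map i) ?index_mem // nth_index //.
    by rewrite valK.
(* Since phi H <> 0, no leading coefficient of the q_i is killed. *)
have aphi i : alg (gen (consts F (size u)) (map phi (t ++ u))) (phi 'X_i).
  have [Gq _ qX] := qP i.
  apply: (alg_image _ Gq qX); first exact: (gen_image phi_consts).
  by apply: contra_neq phiH => e; rewrite /H (bigD1 i) // (rmorphM phi) e mul0r.
have aphiu i : alg (gen (consts F (size u)) (map phi u)) (phi 'X_i).
  apply: gen_trans (aphi i) => y; rewrite map_cat mem_cat => /orP[|yu];
    last exact: alg_gen_mem.
  move=> /mapP[x xt ->]; have /mapP[j _ ex] := tX _ xt.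
  apply/alg_base/gen_base; rewrite ex phiX /subst_var /sg insubN.
    by rewrite -(rmorph_nat (@mpolyC (size u) F)); apply: mem_rimage.
  by rewrite -sJ index_mem mem_filter -ex xt.
apply: (@indep_of_span _ _ _ [seq 'X_j | j <- enum 'I_(size u)]).
- exact/indep_vars/enum_uniq.
- move=> _ /mapP[j _ ->].
  have jJ : (j < size J)%N by rewrite sJ.
  have i0 : 'I_N by case: (J) jJ.
  have := aphiu (nth i0 J j); rewrite phiX /subst_var /sg.
  rewrite index_uniq //; last exact/filter_uniq/enum_uniq.
  rewrite insubT //.
- apply: (@leq_trans (size u)); first by rewrite size_map.
  by rewrite size_map -[X in (X <= _)%N](size_enum_ord (size u)).
Qed.
End Spread.

(** * Krull dimension *)

(** An equation of f1 x whose constant term is nonzero would, modulo the larger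
    kernel, have its constant term as a relation between the elements of s. *)
Lemma indep_strict_incl (R R1 : idomainType) (R2 : comNzRingType) (A : subringClosed R)
    (f1 : {rmorphism R -> R1}) (f2 : {rmorphism R -> R2})
    (A1 : subringClosed R1) (A2 : subringClosed R2) x s :
  (forall b, b \in A1 -> exists2 a, a \in A & f1 a = b) ->
  (forall a, a \in A -> f2 a \in A2) -> (forall a, a \in A -> f2 a = 0 -> a = 0) ->
  (forall a, f1 a = 0 -> f2 a = 0) -> f2 x = 0 -> f1 x != 0 ->
  indep A2 (map f2 s) -> indep A1 (map f1 (x :: s)).
Proof.
move=> sA1 A2A inj ker f2x f1x i2; split; last first.
  by apply: (indep_of_ker (f1 := f1) (f2 := f2) sA1 A2A inj) i2 => a _;
    apply: ker.
move=> [P [AP P0 Px]]; have [Q [AQ Q0 Qx]] := alg_nonzero_const AP P0 Px f1x.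
have [q Gq eq_] := map_poly_lift (gen_image_surj sA1) AQ.
have q0 : q`_0 = 0.
  apply: (indep_gen_inj A2A inj i2); first exact: (polyOverP Gq).
  have := ker q.[x]; rewrite -!horner_map eq_ (rootP Qx) f2x horner_coef0 coef_map.
  exact.
by case/eqP: Q0; rewrite -eq_ coef_map /= q0 rmorph0.
Qed.

Section Localize.
Variables (L : comNzRingType) (G : subringClosed L) (g : L).
Hypothesis Gg : g \in G.
(** For an invertible g, this is the localisation G[1/g]. *)
Definition scaled_into : {pred L} := fun z => `[< exists m, g ^+ m * z \in G >].
Lemma scaled_intoP z : reflect (exists m, g ^+ m * z \in G) (z \in scaled_into).
Proof. exact: asboolP. Qed.
Lemma scaled_into_subring : subring_closed scaled_into.
Proof.
split=> [|x y /scaled_intoP[m mx] /scaled_intoP[n ny]|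
  x y /scaled_intoP[m mx] /scaled_intoP[n ny]]; apply/scaled_intoP.
- by exists 0%N; rewrite mulr1 rpred1.
- exists (m + n)%N; rewrite mulrBr {1}addnC !exprD -!mulrA.
  by rewrite rpredB // rpredM ?rpredX.
- by exists (m + n)%N; rewrite exprD mulrACA rpredM.
Qed.
HB.instance Definition _ := GRing.isSubringClosed.Build L scaled_into scaled_into_subring.
Definition scaled : subringClosed L := scaled_into.
Lemma scaled_into_base z : z \in G -> z \in scaled_into.
Proof. by move=> Gz; apply/scaled_intoP; exists 0%N; rewrite mul1r. Qed.

(** Multiplying an equation of b by a power of F = y g + 1 shows that F divides
    a power of a up to a power of g, and modulo F the element g is invertible, with
    inverse -y. *)
Lemma integral_divisor F y a b : F \in G -> y \in G -> a \in G ->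
  F = y * g + 1 -> a = F * b -> integral scaled b ->
  exists r h, h \in G /\ a ^+ r = F * h.
Proof.
move=> GF Gy Ga eF ea [Q [MQ mQ Qb]].
have [r sQ] : exists r, size Q = r.+2.
  case e: (size Q) => [|[|r]]; last by exists r.
    by have := monic_neq0 mQ; rewrite -size_poly_eq0 e.
  have := monic_neq0 mQ; move: Qb; have /eqP/size_poly1P[c c0 ->] := e.
  by rewrite rootE hornerC (negPf c0).
pose c := - \sum_(j < r.+1) Q`_j * a ^+ j * F ^+ (r - j).
have Mc : c \in scaled_into.
  rewrite rpredN rpred_sum // => j _.
  rewrite !rpredM ?(polyOverP MQ) //; apply/rpredX/scaled_into_base => //.
have ar : a ^+ r.+1 = F * c.
  rewrite /c mulrN mulr_sumr.
  have : F ^+ r.+1 * Q.[b] = 0 by rewrite (rootP Qb) mulr0.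
  rewrite horner_coef sQ big_ord_recr /=.
  have -> : Q`_r.+1 = 1 by move/monicP: mQ; rewrite lead_coefE sQ.
  rewrite mul1r mulrDr -exprMn -ea addrC => /eqP; rewrite addr_eq0 => /eqP->.
  congr (- _); rewrite mulr_sumr; apply: eq_bigr => j _.
  have -> : F ^+ r.+1 = F * (F ^+ (r - j) * F ^+ j).
    by rewrite -exprD subnK ?exprS // -ltnS.
  by rewrite ea exprMn; ring.
have /scaled_intoP[m Gm] := Mc.
(* Expansion of (y g)^m = (F - 1)^m modulo F. *)
have [w [Gw ew]] : exists w, w \in G /\ (y * g) ^+ m = (-1) ^+ m + F * w.
  elim: (m) => [|n [w [Gw ew]]]; first by exists 0;
    rewrite rpred0 mulr0 addr0 !expr0.
  exists ((-1) ^+ n + (F - 1) * w); split.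
    by rewrite rpredD ?rpredX ?rpredN ?rpred1 // rpredM // rpredB ?rpred1.
  by rewrite !exprS ew eF; ring.
exists r.+1, ((-1) ^+ m * (y ^+ m * (g ^+ m * c) - w * a ^+ r.+1)); split.
  by rewrite rpredM ?rpredX ?rpredN ?rpred1 // rpredB // rpredM ?rpredX.
have -> : y ^+ m * (g ^+ m * c) = (y * g) ^+ m * c by rewrite exprMn mulrA.
have s1 : (-1) ^+ m * (-1) ^+ m = 1 :> L by rewrite -exprMn mulrNN mulr1 expr1n.
have -> : F * ((-1) ^+ m * ((y * g) ^+ m * c - w * a ^+ r.+1)) =
    (-1) ^+ m * ((y * g) ^+ m * (F * c) - F * w * a ^+ r.+1) by ring.
by rewrite -ar ew -mulrBl addrK mulrA s1 mul1r.
Qed.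
End Localize.

Section NoMultiple.
Variables (L : fieldType) (A : subringClosed L) (y : L) (gs : seq L).
Local Notation G := (adjoin A y).
Hypothesis y_free : ~ alg A y.
Hypothesis gs_alg : forall z, z \in gs -> alg G z.

Lemma common_denominator : exists g (Gg : g \in G), g != 0 /\
  forall b, b \in gen G gs -> integral (scaled Gg) b.
Proof.
have [g [Gg g0 ig]] : exists g, [/\ g \in G, g != 0 &
    forall z, z \in gs -> exists p, [/\ p \is monic, root p z &
      forall i, g * p`_i \in G]].
  elim: (gs) gs_alg => [|z s IH] az; first by exists 1;
    rewrite rpred1 oner_neq0.
  have [g [Gg g0 ig]] : exists g, [/\ g \in G, g != 0 &
      forall z, z \in s -> exists p, [/\ p \is monic, root p z &
        forall i, g * p`_i \in G]].
    by apply: IH => x xs; apply: az; rewrite inE xs orbT.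
  have [p [Gp p0 pz]] := az z (mem_head _ _).
  have Gl : lead_coef p \in G by apply: (polyOverP Gp).
  have l0 : lead_coef p != 0 by rewrite lead_coef_eq0.
  exists (lead_coef p * g); split; rewrite ?rpredM ?mulf_neq0 // => x.
  rewrite inE => /predU1P[->|/ig[q [mq qx gq]]].
    exists ((lead_coef p)^-1 *: p); split=> [||i].
    - by rewrite monicE lead_coefZ mulVf.
    - by rewrite rootE hornerZ (rootP pz) mulr0.
    - by rewrite coefZ mulrAC mulrA divff // mul1r mulrC rpredM // (polyOverP Gp).
  by exists q; split=> // i; rewrite -mulrA rpredM.
exists g, Gg; split=> // b.
suff sub : {subset gen G gs <= int_closure (scaled Gg)} by move/sub/int_closureP.
apply: gen_min => [z Gz|z /ig[p [mp pz gp]]]; apply/int_closureP.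
  exact/integral_base/scaled_into_base.
exists p; split=> //; apply/polyOverP=> i; apply/scaled_intoP.
by exists 1%N; rewrite expr1.
Qed.

(** Let g be a common denominator of the integral equations of the generators and
    F = y g + 1, a polynomial in y of positive degree. If a in A is a multiple of
    F, then so is some a^r in A[y], and a = 0 by comparison of degrees. *)
Lemma no_multiple_in_base : exists F, [/\ F \in G, F != 0 &
  forall b, b \in gen G gs -> F * b \in A -> F * b = 0].
Proof.
have [g [Gg [g0 ig]]] := common_denominator.
have Gy : y \in G by apply: adjoin_gen.
have GF : y * g + 1 \in G by rewrite rpredD ?rpred1 // rpredM.
have /adjoinP[P AP eg] := Gg.
pose PF := 'X * P + 1.
have sPF : (1 < size PF)%N.
  have P0 : P != 0 by apply: contra_neq g0 => P0; rewrite eg P0 horner0.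
  have sXP : size ('X * P) = (size P).+1 by rewrite mulrC size_mulX.
  by rewrite /PF size_polyDl sXP ?size_poly1 ltnS size_poly_gt0.
have APF : PF \is a polyOver A by rewrite rpredD ?rpred1 // rpredM ?polyOverX.
have ePF : PF.[y] = y * g + 1 by rewrite /PF !hornerE -eg.
have A_inj Q : Q \is a polyOver A -> Q.[y] = 0 -> Q = 0.
  move=> AQ Qy; have [//|Q0] := eqVneq Q 0; case: y_free.
  by exists Q; split=> //; apply/eqP.
exists (y * g + 1); split=> // [|b Gb Aa].
  apply/eqP; rewrite -ePF => /(A_inj _ APF) PF0.
  by rewrite PF0 size_poly0 in sPF.
set a := _ * b in Aa *.
have Ga : a \in G by apply: adjoin_base.
have [r [h [Gh eh]]] := integral_divisor GF Gy Ga erefl erefl (ig b Gb).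
have /adjoinP[R AR eR] := Gh.
have : PF * R - (a ^+ r)%:P = 0.
  apply: A_inj; first by rewrite rpredB ?rpredM // polyOverC rpredX.
  by rewrite hornerD hornerN hornerM hornerC ePF -eR eh subrr.
move/eqP; rewrite subr_eq0 => /eqP e.
have [R0|R0] := eqVneq R 0.
  by apply/eqP; move: eh; rewrite eR R0 horner0 mulr0 => /eqP;
    rewrite expf_eq0 => /andP[].
have : (size (PF * R)%R <= 1)%N by rewrite e size_polyC leq_b1.
rewrite size_mul // -?size_poly_gt0 ?(ltnW sPF) //.
move: sPF R0; rewrite -!size_poly_gt0.
by case: (size PF) => [|[|m]] //; case: (size R) => //= n _ _; rewrite addnS.
Qed.
End NoMultiple.

Section PrimeAvoidance.
Variables (R : comNzRingType) (I0 M : R -> Prop).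
Definition ideal_prop (I : R -> Prop) : Prop :=
  I 0 /\ forall a u v, I u -> I v -> I (a * u + v).
Hypothesis I0_ideal : ideal_prop I0.
Hypothesis M1 : M 1.
Hypothesis MM : forall a b, M a -> M b -> M (a * b).
Hypothesis disj : forall a, I0 a -> M a -> False.

(** An ideal that is maximal among those containing I0 and disjoint from M is
    prime. *)
Lemma prime_avoid : exists q : Spec R,
  (forall a, I0 a -> a \in q) /\ forall a, M a -> a \notin q.
Proof.
pose good I := [/\ ideal_prop I, forall a, I0 a -> I a & forall a, I a -> M a -> False].
pose T := {I : R -> Prop | good I}.
have g0 : good I0 by split.
pose rel (I J : T) := `[< forall a, sval I a -> sval J a >].
have [|||[q gq] qmax] := @classical_sets.ZL_preorder T (exist _ _ g0) rel.
- by move=> I; apply/asboolP.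
- by move=> I J K /asboolP IJ /asboolP JK; apply/asboolP => a /IJ/JK.
- move=> A tot; case: (pselect (exists I, A I)) => [[I AI]|nA]; last first.
    by exists (exist _ _ g0) => J AJ; case: nA; exists J.
  pose U a := exists2 J : T, A J & sval J a.
  have gU : good U.
    split.
    - split; first by exists I => //; case: (svalP I) => -[].
      move=> a u v [J AJ Ju] [K AK Kv].
      case: (tot J K AJ AK) => /asboolP JK.
        by exists K => //; case: (svalP K) => -[_ h] _ _; apply: h => //;
          apply: JK.
      by exists J => //; case: (svalP J) => -[_ h] _ _; apply: h => //;
        apply: JK.
    - by move=> a I0a; exists I => //; case: (svalP I) => _ + _; apply.
    - by move=> a [J AJ Ja]; case: (svalP J) => _ _; apply.
  by exists (exist _ _ gU) => J AJ; apply/asboolP => a Ja; exists J.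
have [[q0 qD] I0q qM] := gq.
pose Q : {pred R} := fun a => `[< q a >].
have QP a : reflect (q a) (a \in Q) by apply: asboolP.
have Qid : idealr_closed Q.
  split; [exact/QP|apply/negP => /QP h; exact: qM h M1|].
  by move=> a u v /QP qu /QP qv; apply/QP/qD.
have bigger u : u \notin Q -> exists r, exists2 c, q c & M (r * u + c).
  move=> /QP nu; apply: contrapT => nM.
  pose J a := exists r, exists2 c, q c & a = r * u + c.
  have gJ : good J.
    split.
    - split; first by exists 0, 0 => //; rewrite mul0r addr0.
      move=> a _ _ [r [c qc ->]] [s [d qd ->]].
      by exists (a * r + s), (a * c + d); [apply: qD|ring].
    - by move=> a /I0q qa; exists 0, a => //; rewrite mul0r add0r.
    - by move=> _ [r [c qc ->]] Ma; apply: nM; exists r, c.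
  have /asboolP /(_ u) /= : rel (exist _ _ gJ) (exist _ _ gq).
    by apply: qmax; apply/asboolP => a qa /=; exists 0, a => //;
      rewrite mul0r add0r.
  by move=> h; apply/nu/h; exists 1, 0 => //; rewrite mul1r addr0.
have Qpr : prime_idealr_closed Q.
  move=> u v /QP quv; apply: contrapT => /negP; rewrite negb_or => /andP[nu nv].
  have [r [c qc Mu]] := bigger _ nu; have [s [d qd Mv]] := bigger _ nv.
  apply: (qM _ _ (MM Mu Mv)).
  have -> : (r * u + c) * (s * v + d) =
    (r * s) * (u * v) + ((r * u) * d + (s * v + d) * c) by ring.
  have qZ a x : q x -> q (a * x) by move=> qx; rewrite -[_ * _]addr0; apply: qD.
  by apply: (qD _ _ _ quv); apply: (qD _ _ _ qd); apply: qZ.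
pose q' : Spec R := HB.pack Q (isIdealr.Build R Q Qid)
  (isPrimeIdealrClosed.Build R Q Qpr).
exists q'; split=> a; first by move=> /I0q qa; apply/QP.
by move=> Ma; apply/QP => qa; apply: qM qa Ma.
Qed.
End PrimeAvoidance.

Section Krull.
Variables (k : fieldType) (B : domAlgType k).

Definition to_resm (p : Spec B) : {rmorphism B -> resfield p} := to_res p.
Definition res_scal (p : Spec B) : subringClosed (resfield p) :=
  rimage (to_resm p \o in_alg B).
(** Independence, and then algebraic dependence of everything, in B / p. *)
Definition indep_at (p : Spec B) (s : seq B) : Prop :=
  indep (res_scal p) (map (to_resm p) s).
Definition span_at (p : Spec B) (s : seq B) : Prop :=
  forall b, alg (gen (res_scal p) (map (to_resm p) s)) (to_resm p b).

Lemma to_resm_eq0 p b : (to_resm p b = 0) <-> (b \in p).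
Proof. by rewrite -to_res_eq0; split=> [->|/eqP//]. Qed.

Lemma res_scal_surj p b : b \in res_scal p -> exists2 a, a \in scal B & to_resm p a = b.
Proof. by move=> /rimageP[c ->]; exists c%:A => //;
  apply: (mem_rimage (in_alg B)). Qed.

Lemma res_scal_img p a : a \in scal B -> to_resm p a \in res_scal p.
Proof. by move=> /rimageP[c ->]; apply/rimageP; exists c. Qed.

Lemma indep_at_gen (p : Spec B) s a :
  indep_at p s -> a \in gen (scal B) s -> a \in p -> a = 0.
Proof.
move=> i Ga /to_resm_eq0; apply: (indep_gen_inj (@res_scal_img p) _ i) => //.
exact: scal_inj.
Qed.

Lemma indep_at_drop (p q : Spec B) x s : {subset p <= q} -> x \in q -> x \notin p ->
  indep_at q s -> indep_at p (x :: s).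
Proof.
move=> pq xq xp.
apply: (indep_strict_incl (f1 := to_resm p) (f2 := to_resm q) (@res_scal_surj p) (@res_scal_img q)).
- exact: scal_inj.
- by move=> a /to_resm_eq0/pq/to_resm_eq0.
- exact/to_resm_eq0.
- by rewrite to_res_eq0.
Qed.

Lemma indep_at_indep p s : indep_at p s -> indep (scal B) s.
Proof.
rewrite -[X in indep _ X]map_id.
apply: (indep_of_ker (A := scal B) (f1 := idfun) (f2 := to_resm p)) => //.
- by move=> b; exists b.
- exact: res_scal_img.
- exact: scal_inj.
- by move=> a _ /= ->; rewrite rmorph0.
Qed.

Lemma indep_at_sub (p q : Spec B) s : indep_at p s ->
  (forall a, a \in gen (scal B) s -> a \in q -> a \in p) -> indep_at q s.
Proof.
move=> i h.
apply: (indep_of_ker (f1 := to_resm q) (f2 := to_resm p)) i.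
- exact: res_scal_surj.
- exact: res_scal_img.
- exact: scal_inj.
- by move=> a Ga /to_resm_eq0/(h _ Ga)/to_resm_eq0.
Qed.

Variable gs : seq B.
Hypothesis Bgs : forall b, b \in gen (scal B) gs.

(** The prime q is a maximal ideal among those that contain p and f, a lift of the
    element F of no_multiple_in_base, and meet k[s] only in 0. If b were
    independent of s modulo q, then f, b, s would be independent modulo p, against
    the size of the basis y, s. *)
Lemma extend_prime (p : Spec B) y s : indep_at p (y :: s) -> span_at p (y :: s) ->
  exists q : Spec B, [/\ {subset p <= q}, ~ {subset q <= p}, indep_at q s &
    span_at q s].
Proof.
move=> iys sys; have [ny is_] := iys.
have [|F [GF F0 Fmul]] := @no_multiple_in_base _ _ _ (map (to_resm p) gs) ny.
  by move=> _ /mapP[g _ ->]; apply: sys.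
have [f Gf ef] := gen_image_surj (@res_scal_surj p)
  (GF : F \in gen (res_scal p) (map (to_resm p) (y :: s))).
pose I0 z := exists b c, c \in p /\ z = f * b + c.
pose M a := a \in gen (scal B) s /\ a != 0.
have [|||a|q [I0q Mq]] := @prime_avoid B I0 M.
- split; first by exists 0, 0; rewrite rpred0 mulr0 addr0.
  move=> a _ _ [b [c [cp ->]]] [b' [c' [cp' ->]]].
  exists (a * b + b'), (a * c + c'); split; first by rewrite rpredD // idealMr.
  by rewrite !mulrDr !addrA; congr (_ + _); rewrite mulrCA addrAC.
- by split; [apply: rpred1|apply: oner_neq0].
- by move=> a b [Ga a0] [Gb b0]; split; [apply: rpredM|rewrite mulf_neq0].
- move=> [b [c [cp ea]]] [Ga /eqP]; apply.
  apply: (indep_at_gen is_ Ga); apply/to_resm_eq0.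
  have e : to_resm p a = F * to_resm p b.
    by rewrite ea rmorphD rmorphM ef (iffRL (to_resm_eq0 p c)) // addr0.
  rewrite e; apply: Fmul; last by rewrite -e;
    apply: (gen_image (@res_scal_img p)).
  have := gen_image (@res_scal_img p) (Bgs b).
  apply: gen_min => [z zs|z]; last exact: gen_mem.
  exact/gen_base/adjoin_base/gen_base.
have pq : {subset p <= q} by move=> c cp; apply: I0q; exists 0, c;
  rewrite mulr0 add0r.
have fq : f \in q by apply: I0q; exists 1, 0; rewrite rpred0 mulr1 addr0.
have fp : f \notin p by rewrite -to_res_eq0 -[to_res p f]/(to_resm p f) ef.
have iq : indep_at q s.
  apply: (indep_at_sub is_) => a Ga aq.
  have [->|a0] := eqVneq a 0; first exact: rpred0.
  by have := Mq a (conj Ga a0); rewrite aq.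
exists q; split=> // [qp|b]; first by rewrite qp in fp.
apply: contrapT => nb.
have : indep_at p (f :: b :: s) by apply: (indep_at_drop pq fq fp); split.
move=> /(steinitz (v := map (to_resm p) (y :: s))) h.
suff /h : forall z, z \in map (to_resm p) [:: f, b & s] ->
    alg (gen (res_scal p) (map (to_resm p) (y :: s))) z by rewrite /= ltnn.
by move=> _ /mapP[x _ ->]; apply: sys.
Qed.

Lemma chain_of_basis n p s : size s = n -> indep_at p s -> span_at p s ->
  exists c : nat -> Spec B, c 0%N = p /\ forall i, (i < n)%N ->
    {subset c i <= c i.+1} /\ ~ {subset c i.+1 <= c i}.
Proof.
elim: n p s => [|n IH] p [|y s] //= => [_ _ _|[ss] iys sys];
  first by exists (fun=> p).
have [q [pq qp iq sq]] := extend_prime iys sys.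
have [c [c0 cP]] := IH q s ss iq sq.
exists (fun i => if i is j.+1 then c j else p); split=> // -[_|i];
  last exact: cP.
by rewrite c0.
Qed.

Variable bs : seq B.
Hypothesis bs_indep : indep (scal B) bs.
Hypothesis bs_alg : forall b, alg (gen (scal B) bs) b.

Lemma chain_bound n : prime_chain B n -> (n <= size bs)%N.
Proof.
move=> [c cP].
have h m : (m <= n)%N -> exists s, size s = m /\ indep_at (c (n - m)%N) s.
  elim: m => [_|m IH lt]; first by exists [::].
  have [s [ss is_]] := IH (ltnW lt).
  have [] := cP (n - m.+1)%N; first by rewrite ltn_subrL (leq_trans _ lt).
  rewrite -subSn // subSS => cc nc.
  have [x [xq xp]] : exists x, x \in c (n - m)%N /\ x \notin c (n - m.+1)%N.
    apply: contrapT => nx; apply: nc => x xq; apply/negPn/negP => xp.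
    by apply: nx; exists x.
  by exists (x :: s); split; [rewrite /= ss|apply: indep_at_drop is_].
have [s [<- is_]] := h n (leqnn n).
by apply: steinitz (indep_at_indep is_) _ => x _; apply: bs_alg.
Qed.

Lemma krull_dim : is_krull_dim B (size bs).
Proof.
split; last exact: chain_bound.
have z0 b : to_resm (zero_prime B) b = 0 -> b = 0.
  by move/to_resm_eq0; rewrite in_zero_prime => /eqP.
have ib : indep_at (zero_prime B) bs.
  apply: (indep_of_ker (f1 := to_resm (zero_prime B)) (f2 := idfun)
    (A := scal B) (A2 := scal B)) => //.
  - exact: res_scal_surj.
  - by move=> a _ /z0.
  - by rewrite map_id.
have sb : span_at (zero_prime B) bs.
  move=> b; have [P [GP P0 Pb]] := bs_alg b.
  apply: (alg_image (f := to_resm (zero_prime B)) _ GP Pb).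
    exact: (gen_image (@res_scal_img (zero_prime B))).
  by apply: contra_neq P0 => /z0/eqP; rewrite lead_coef_eq0 => /eqP.
have [c [_ cP]] := chain_of_basis erefl ib sb.
by exists c.
Qed.
End Krull.

(** * Embedding into a polynomial ring, and conclusion *)

Lemma indep_subst (F : idomainType) N n (sg : 'I_N -> nat + 'I_n)
    (I : seq {mpoly F[N]}) :
  indep (consts F n) (map (@subst F N n sg) I) -> indep (consts F N) I.
Proof. exact/indep_of_image/substC. Qed.

Lemma subst_alg_inj (F : idomainType) N n (sg : 'I_N -> nat + 'I_n)
    (I : seq {mpoly F[N]}) x :
  indep (consts F n) (map (@subst F N n sg) I) ->
  alg (gen (consts F N) I) x -> @subst F N n sg x = 0 -> x = 0.
Proof.
move=> iI; apply: alg_ker_trivial => a; apply: gen_inj_of_image iI;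
  exact: substC.
Qed.

Lemma indep_map_inj (R S : idomainType) (g : {rmorphism R -> S}) N (u : seq {mpoly R[N]}) :
  injective g -> indep (consts S N) (map (map_mpoly g) u) -> indep (consts R N) u.
Proof.
move=> gi i; rewrite -[u]map_id.
apply: (indep_of_ker (A := consts R N) (f1 := idfun)
  (f2 := map_mpoly g : {rmorphism {mpoly R[N]} -> {mpoly S[N]}})) i => //.
- by move=> b Cb; exists b.
- by move=> _ /rimageP[c ->]; rewrite /= map_mpolyC mem_rimage.
- move=> _ /rimageP[c ->]; rewrite /= map_mpolyC => /(congr1 (mcoeff 0%MM)).
  rewrite mcoeffC eqxx mulr1 mcoeff0 -(rmorph0 g) => /gi ->.
  by rewrite /= mpolyC0.
- by move=> a _ /= ->; rewrite rmorph0.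
Qed.

Lemma mpoly_scale_mul (F : comNzRingType) N (a b : F) (P Q : {mpoly F[N]}) :
  (a * b) *: (P * Q) = (a *: P) * (b *: Q).
Proof. by rewrite -scalerAl -scalerAr scalerA. Qed.

Lemma mpoly_sum_mul (F : comNzRingType) N I J (r : seq I) (s : seq J)
    (P : I -> {mpoly F[N]}) (Q : J -> {mpoly F[N]}) :
  \sum_(i <- r) \sum_(j <- s) P i * Q j = (\sum_(i <- r) P i) * (\sum_(j <- s) Q j).
Proof.
by rewrite mulr_suml; apply: eq_bigr => i _; rewrite mulr_sumr.
Qed.

Section HatPsiMorph.
Variables (k : fieldType) (B : domAlgType k).
Hypothesis k0 : [pchar k] =i pred0.
Variables (N : nat) (S : N.-tuple (lnd B)) (p : Spec B).
Local Notation kap := (resfield p).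

Lemma hatPsi_monoid : monoid_morphism (hatPsi S (p := p)).
Proof.
have bal := hatPsi_balanced S k0 p.
split=> [|x y].
  rewrite -[1]/(ptens 1 1 : ktens p) hatPsi_ptens // -(Psi_at_rmE k0) rmorph1.
  exact: (@scale1r kap {mpoly kap[N]}).
elim/tens_ind: x => s; elim/tens_ind: y => t.
rewrite /hatPsi -[to_tens s * to_tens t]to_tensM !(tens_lift_to bal).
rewrite /tmulT big_allpairs_dep /= -(@mpoly_sum_mul kap N).
apply: eq_bigr => z _; apply: eq_bigr => z' _.
by rewrite (Psi_atM k0); apply: (@mpoly_scale_mul kap N).
Qed.

Lemma embeds_of_subst n (sg : 'I_N -> nat + 'I_n) (I : seq B) :
  injective (hatPsi S (p := p)) ->
  (forall b, alg (gen (consts kap N) (map (Psi_at S p) I)) (Psi_at S p b)) ->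
  indep (consts kap n) (map (@subst kap N n sg) (map (Psi_at S p) I)) ->
  embeds_in_poly p n.
Proof.
move=> hinj aI iI.
pose h : {rmorphism ktens p -> {mpoly kap[N]}} :=
  HB.pack (@hatPsi k B N S p)
   (GRing.isZmodMorphism.Build _ _ (@hatPsi k B N S p) (hatPsi_zmod S k0 (p := p)))
   (GRing.isMonoidMorphism.Build _ _ (@hatPsi k B N S p) hatPsi_monoid).
pose f : {rmorphism ktens p -> {mpoly kap[n]}} :=
  (@subst kap N n sg : {rmorphism _ -> _}) \o h.
have fZ : scalable f.
  by move=> a x; rewrite /= hatPsi_scalable // substZ.
pose ff : {lrmorphism ktens p -> {mpoly kap[n]}} :=
  HB.pack (f : ktens p -> {mpoly kap[n]}) (GRing.RMorphism.class f)
    (GRing.isScalable.Build kap (ktens p) {mpoly kap[n]} *:%R f fZ).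
exists ff.
have f0 x : f x = 0 -> x = 0.
  move=> fx; apply: hinj; apply: etrans (esym (rmorph0 h)).
  apply: (@subst_alg_inj kap N n sg _ _ iI) fx.
  have [m [l [b [_ ->]]]] := tens_linfree x.
  rewrite raddf_sum /=; under eq_bigr do rewrite hatPsi_ptens //.
  exact: (@alg_lincomb kap N).
move=> x y e; apply/eqP; rewrite -subr_eq0; apply/eqP/f0.
by rewrite rmorphB; apply/eqP; rewrite subr_eq0; apply/eqP.
Qed.
End HatPsiMorph.

Section Main.
Variables (k : fieldType) (B : domAlgType k).
Hypothesis k0 : [pchar k] =i pred0.

Lemma natr_char0_alg n : (n.+1%:R : B) != 0.
Proof. by rewrite -(rmorph_nat (in_alg B)) fmorph_eq0 natr_char0. Qed.

Lemma fg_basis : finitely_generated B -> exists gs bs,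
  [/\ forall b : B, b \in gen (scal B) gs, indep (scal B) bs &
      forall b, alg (gen (scal B) bs) b].
Proof.
move=> [n [g gP]]; pose gs := [seq g i | i <- enum 'I_n].
have ggs b : b \in gen (scal B) gs.
  have [P ->] := gP b; rewrite /mmap rpred_sum // => m _; rewrite rpredM //.
    exact/gen_base/(mem_rimage (in_alg B)).
  rewrite /mmap1 rpred_prod // => i _; rewrite rpredX // gen_mem //.
  by apply: map_f; rewrite mem_enum.
have [t [_ it gst]] := @indep_extend B (scal B) [::] gs I.
rewrite cats0 in it gst.
exists gs, t; split=> // b.
by apply: gen_trans gst _; apply/alg_base.
Qed.

Definition basic_open (f : B) (p : Spec B) : Prop := f \notin p.
Lemma basic_open_open f : zariski_open (basic_open f).
Proof. by exists (eq f) => p; split=> [fp|[_ <-]//]; exists f. Qed.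
Lemma basic_open_nonempty f : f != 0 -> exists p, basic_open f p.
Proof. by move=> f0; exists (zero_prime B);
  rewrite /basic_open in_zero_prime. Qed.

Variable bs : seq B.
Hypothesis bs_indep : indep (scal B) bs.
Hypothesis bs_alg : forall b, alg (gen (scal B) bs) b.
Variable Delta : lnd B -> Prop.
Hypothesis KD : forall x, KDelta Delta x -> scalars x.

(** One open set serves both parts: there the images of the basis remain
    independent even after the substitution into d variables. *)
Lemma open_embedding : exists N (S : N.-tuple (lnd B)) f,
  [/\ forall j, Delta (tnth S j), (exists D, Delta D) -> (0 < N)%N, f != 0 &
   forall p, basic_open f p -> injective (hatPsi S (p := p)) /\
     embeds_in_poly p (size bs)].
Proof.
have [N [S [DS N0 i0]]] := generic_indep k0 bs_indep bs_alg KD.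
have iu : indep (consts B N) (map (Psi S) bs).
  apply: (@indep_map_inj B (resfield (zero_prime B)) (to_res (zero_prime B))).
    move=> a b /eqP; rewrite -subr_eq0 -rmorphB to_res_eq0 in_zero_prime.
    by rewrite subr_eq0 => /eqP.
  by rewrite -map_comp.
have [f [sg [f0 sp]]] := independence_spreads natr_char0_alg iu.
exists N, S, f; split=> // p fp.
have iJ : indep (consts (resfield p) (size (map (Psi S) bs)))
    (map (@subst (resfield p) N _ sg) (map (Psi_at S p) bs)).
  have := sp (resfield p) (to_res p).
  by rewrite to_res_eq0 => /(_ fp); rewrite -!map_comp.
have iI := @indep_subst (resfield p) N _ sg _ iJ.
have hinj := hatPsi_inj_of_indep k0 bs_alg KD iI.
split=> //; rewrite -(size_map (Psi S) bs).
apply: (embeds_of_subst k0 hinj _ iJ).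
by apply: (Psi_at_alg k0 bs_alg) => b _; apply: (Psi_at_alg_inj k0 bs_alg iI).
Qed.
End Main.

Theorem theorem3p8 (k : fieldType) (B : domAlgType k) :
  [pchar k] =i pred0 ->
  finitely_generated B ->
  same_set (FML (B := B)) (scalars (B := B)) ->
  (* (a) *)
  (has_nonempty_interior (Xset (B := B)) /\
   exists d : nat, is_krull_dim B d /\
     has_nonempty_interior (fun p : Spec B => embeds_in_poly p d)) /\
  (* (b) *)
  (forall Delta : lnd B -> Prop,
     same_set (KDelta Delta) (scalars (B := B)) ->
     exists (N : nat) (S : N.-tuple (lnd B)) (U : Spec B -> Prop),
       [/\ (exists D, Delta D) -> (0 < N)%N,
           forall j, Delta (tnth S j),
           zariski_open U,
           exists p, U p &
           forall p, U p -> injective (hatPsi S (p := p))]).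
Proof.
move=> k0 fgB fml; have [gs [bs [Bgs ibs abs]]] := fg_basis fgB; split.
  have [N [S [f [_ _ f0 fP]]]] := open_embedding k0 ibs abs (fun x => iffLR (fml x)).
  have int : has_nonempty_interior (fun p : Spec B => embeds_in_poly p (size bs)).
    exists (basic_open f); split; [exact: basic_open_open|exact: basic_open_nonempty|].
    by move=> p /fP[].
  split; last first.
    have dimB := krull_dim Bgs ibs abs.
    by exists (size bs).
  by have [U [oU nU UP]] := int; exists U; split=> // p /UP; exists (size bs).
move=> Delta KD.
have [N [S [f [DS N0 f0 fP]]]] := open_embedding k0 ibs abs (fun x => iffLR (KD x)).
exists N, S, (basic_open f); split=> //; first exact: basic_open_open.
  exact: basic_open_nonempty.
by move=> p /fP[].
Qed.
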